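(* Let $n\geqslant1$ and let $S$ be a set of positive integers closed under taking divisors. There is a bilinear morphism of functors $$L^nK^M_n\times L^nW_S\longrightarrow W_S,\qquad \big(\{f_1,\ldots,f_n\},(g_i)_{i\in S}\big)\longmapsto(f_1,\ldots,f_n\mid g_1,g_2,\ldots],$$ given in the ghost coordinates by the formula $$(f_1,\ldots,f_n\mid g_1,g_2,\ldots](i)=\mathrm{res}\left(g(i)\,\frac{df_1}{f_1}\wedge\ldots\wedge\frac{df_n}{f_n}\right),\qquad i\in S,$$ where $\{f_1,\ldots,f_n\}$, $f_k\in\mathcal L^n(A)^*$, is a symbol in $K^M_n(\mathcal L^n(A))$, $g=(g_i)_{i\in S}$ is a Witt vector in $W_S(\mathcal L^n(A))$, and $A$ is a ring.
   Context: All rings are commutative, associative and unital; functors are covariant functors on the category of rings. $A((t))=A[[t]][t^{-1}]$, $\mathcal L^n(A)=A((t_1))\ldots((t_n))$, and $L^nF(A)=F(\mathcal L^n(A))$ for a functor $F$. The Milnor $K$-group $K^M_m(A)$ is the quotient of $(A^* )^{\otimes m}$ by the subgroup generated by all $a_1\otimes\ldots\otimes a_i\otimes a\otimes(1-a)\otimes a_{i+3}\otimes\ldots\otimes a_m$; $\{a_1,\ldots,a_m\}$ is the class of $a_1\otimes\ldots\otimes a_m$. Witt vectors: $W_S(A)=\{w=(w_i)_{i\in S}\mid w_i\in A\}$, with ghost coordinates $w(i)=\sum_{d\mid i}d\,w_d^{i/d}$, $i\in S$. Addition on $W_S(A)$ is given by the unique polynomials with integral coefficients in the $w_i$ for which addition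 is coordinate-wise in the ghost coordinates; $W_S$ is regarded as a group functor with this addition. Forms are taken in the exterior algebra of the free $\mathcal L^n(A)$-module with basis $dt_1,\ldots,dt_n$, with $df=\sum_j\frac{\partial f}{\partial t_j}dt_j$, and $\mathrm{res}\big(\sum_{l\in\mathbb Z^n}a_l\,t_1^{l_1}\cdots t_n^{l_n}\,dt_1\wedge\ldots\wedge dt_n\big)=a_{-1,\ldots,-1}\in A$. *)

(* Defs.v *)
From HB Require Import structures.
From mathcomp Require Import all_boot all_order all_algebra.
From mathcomp Require Import boolp classical_sets fsbigop cardinality.
From mathcomp.multinomials Require Import freeg mpoly.
From mathcomp Require Import zify ring.

Set Implicit Arguments.
Unset Strict Implicit.
Unset Printing Implicit Defensive.

Import Order.TTheory GRing.Theory Num.Theory.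
Local Open Scope ring_scope.

(* A((t)): the families of coefficients that vanish below some -N. *)
Record laurent (A : nmodType) := Laurent {
  lcoef :> int -> A;
  lcoef_bounded : exists N : nat, forall i : int, i < - N%:Z -> lcoef i = 0 }.

Lemma laurentP (A : nmodType) (f g : laurent A) : f =1 g -> f = g.
Proof.
case: f g => f f0 [g g0] /= /funext fg; move: f0 g0; rewrite fg => f0 g0.
by congr Laurent; exact: Prop_irrelevance.
Qed.

HB.instance Definition _ (A : nmodType) := gen_eqMixin (laurent A).
HB.instance Definition _ (A : nmodType) := gen_choiceMixin (laurent A).

Section LaurentZmod.
Context (A : zmodType).
Implicit Types f g h : laurent A.

Fact lzero_bounded : exists N : nat, forall i : int, i < - N%:Z -> (0 : A) = 0.
Proof. by exists 0%N. Qed.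
Definition lzero : laurent A := Laurent lzero_bounded.

Fact lopp_bounded f : exists N : nat, forall i : int, i < - N%:Z -> - f i = 0.
Proof. by have [N fN] := lcoef_bounded f; exists N => i /fN->; rewrite oppr0. Qed.
Definition lopp f : laurent A := Laurent (lopp_bounded f).

Fact ladd_bounded f g :
  exists N : nat, forall i : int, i < - N%:Z -> f i + g i = 0.
Proof.
have [M fM] := lcoef_bounded f; have [N gN] := lcoef_bounded g.
by exists (M + N)%N => i iMN; rewrite fM ?gN ?addr0//; lia.
Qed.
Definition ladd f g : laurent A := Laurent (ladd_bounded f g).

Fact laddA : associative ladd.
Proof. by move=> f g h; apply: laurentP => i /=; rewrite addrA. Qed.
Fact laddC : commutative ladd.
Proof. by move=> f g; apply: laurentP => i /=; rewrite addrC. Qed.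
Fact ladd0 : left_id lzero ladd.
Proof. by move=> f; apply: laurentP => i /=; rewrite add0r. Qed.
Fact laddN : left_inverse lzero lopp ladd.
Proof. by move=> f; apply: laurentP => i /=; rewrite addNr. Qed.

HB.instance Definition _ :=
  GRing.isZmodule.Build (laurent A) laddA laddC ladd0 laddN.

End LaurentZmod.

Section IntSum.
Context (A : zmodType).
Implicit Types F : int -> A.
Local Open Scope classical_set_scope.

Lemma intsumE (a : int) (n : nat) F :
    (forall i, (i < a) || (a + n%:Z <= i) -> F i = 0) ->
  \sum_(i \in [set: int]) F i = \sum_(j < n) F (a + j%:Z).
Proof.
move=> F0; pose r := [seq a + j%:Z | j <- iota 0 n].
have r_uniq : uniq r by rewrite map_inj_uniq ?iota_uniq// => x y; lia.
rewrite -(fsbig_widen [set` r])//=; last first.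
  move=> i [_ /= ir]; apply: F0; apply: contra_notT ir => iN.
  by apply/mapP; exists `|i - a|%N; rewrite ?mem_iota; lia.
rewrite -fsbig_seq// big_map -[in iota _ _](subn0 n).
by rewrite -[RHS](big_mkord xpredT (fun j => F (a + j%:Z))).
Qed.

Lemma intsum_shift (c : int) F :
  \sum_(i \in [set: int]) F i = \sum_(i \in [set: int]) F (c + i).
Proof.
apply: (reindex_fsbigT (fun i => c + i)).
by exists (fun i => i - c) => i; lia.
Qed.

Lemma intsum_rev (c : int) F :
  \sum_(i \in [set: int]) F i = \sum_(i \in [set: int]) F (c - i).
Proof.
apply: (reindex_fsbigT (fun i => c - i)).
by exists (fun i => c - i) => i; lia.
Qed.

End IntSum.

Section LaurentRing.
Context (A : comPzRingType).
Implicit Types f g h : laurent A.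
Local Open Scope classical_set_scope.

(* A finitely supported sum, since f and g vanish below some bound. *)
Definition lmul_coef f g (k : int) : A := \sum_(i \in [set: int]) f i * g (k - i).

Lemma lmul_coefE f g (k a : int) (n : nat) :
    (forall i, i < a -> f i = 0) ->
    (forall j, j <= k - a - n%:Z -> g j = 0) ->
  lmul_coef f g k = \sum_(j < n) f (a + j%:Z) * g (k - (a + j%:Z)).
Proof.
move=> fa gb; rewrite /lmul_coef (intsumE (a := a) (n := n))// => i /orP[/fa->|ai].
  by rewrite mul0r.
by rewrite [g _]gb ?mulr0//; lia.
Qed.

Lemma lmul_coef0 f g (M N : nat) :
    (forall i, i < - M%:Z -> f i = 0) -> (forall i, i < - N%:Z -> g i = 0) ->
  forall k, k < - (M + N)%N%:Z -> lmul_coef f g k = 0.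
Proof.
move=> fM gN k kMN; rewrite (lmul_coefE (a := - M%:Z) (n := 0)) ?big_ord0// => j.
by move=> jk; apply: gN; lia.
Qed.

Fact lmul_bounded f g :
  exists N : nat, forall i : int, i < - N%:Z -> lmul_coef f g i = 0.
Proof.
have [M fM] := lcoef_bounded f; have [N gN] := lcoef_bounded g.
by exists (M + N)%N; apply: lmul_coef0.
Qed.
Definition lmul f g : laurent A := Laurent (lmul_bounded f g).

Fact lone_bounded :
  exists N : nat, forall i : int, i < - N%:Z -> (i == 0)%:R = 0 :> A.
Proof. by exists 0%N => i i0; rewrite (_ : i == 0 = false)//; lia. Qed.
Definition lone : laurent A := Laurent lone_bounded.

Fact lmulC : commutative lmul.
Proof.
move=> f g; apply: laurentP => k /=; rewrite /lmul_coef (intsum_rev k).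
by apply: eq_fsbigr => i _; rewrite subKr mulrC.
Qed.

Lemma lcoef_bounded3 f g h : exists N : nat, forall i : int, i < - N%:Z ->
  [/\ f i = 0, g i = 0 & h i = 0].
Proof.
have [K fK] := lcoef_bounded f; have [M gM] := lcoef_bounded g.
have [N hN] := lcoef_bounded h; exists (K + M + N)%N => i iN.
by split; [apply: fK|apply: gM|apply: hN]; lia.
Qed.

Fact lmulA : associative lmul.
Proof.
move=> f g h; apply: laurentP => k; have [N N0] := lcoef_bounded3 f g h.
have fN i : i < - N%:Z -> f i = 0 by case/N0.
have gN i : i < - N%:Z -> g i = 0 by case/N0.
have hN i : i < - N%:Z -> h i = 0 by case/N0.
pose M := (`|k| + 4 * N + 4)%N.
rewrite [LHS](lmul_coefE (a := - N%:Z) (n := M))//; last first.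
  by move=> j jM; apply: (lmul_coef0 gN hN); lia.
rewrite [RHS](lmul_coefE (a := - (N + N)%N%:Z) (n := M)); last first.
- by move=> j jM; apply: hN; lia.
- exact: lmul_coef0.
under [RHS]eq_bigr => p _.
  rewrite [lmul f g _](lmul_coefE (a := - N%:Z) (n := M))//; last first.
    by move=> j jM; apply: gN; have := ltn_ord p; lia.
  rewrite mulr_suml; over.
rewrite exchange_big/=; apply: eq_bigr => q _.
rewrite [lmul_coef g h _](lmul_coefE (a := - N%:Z - q%:Z) (n := M)); last first.
- by move=> j jM; apply: hN; lia.
- by move=> j jM; apply: gN; lia.
rewrite mulr_sumr; apply: eq_bigr => p _; rewrite mulrA.
by congr (_ * g _ * h _); lia.
Qed.

Fact lmul1 : left_id lone lmul.
Proof.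
move=> f; apply: laurentP => k /=; have [N fN] := lcoef_bounded f.
rewrite (lmul_coefE (a := 0) (n := (`|k| + N).+1)).
- rewrite big_ord_recl big1 => [|i _] /=.
    by rewrite mul1r addr0; congr (f _); lia.
  by rewrite mul0r.
- by move=> i i0 /=; rewrite (_ : i == 0 = false)//; lia.
- by move=> j jk; apply: fN; lia.
Qed.

Fact lmulDl : left_distributive lmul (@ladd A).
Proof.
move=> f g h; apply: laurentP => k /=; have [N N0] := lcoef_bounded3 f g h.
have fN i : i < - N%:Z -> f i = 0 by case/N0.
have gN i : i < - N%:Z -> g i = 0 by case/N0.
have hN i : i < - N%:Z -> h i = 0 by case/N0.
pose M := (`|k| + 4 * N + 4)%N.
rewrite !(lmul_coefE (a := - N%:Z) (n := M))//.
- by rewrite -big_split; apply: eq_bigr => i _; exact: mulrDl.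
- by move=> j jM; apply: hN; lia.
- by move=> j jM; apply: hN; lia.
- by move=> i iN /=; rewrite fN// gN// addr0.
- by move=> j jM; apply: hN; lia.
Qed.

HB.instance Definition _ := GRing.Zmodule_isComPzRing.Build (laurent A)
  lmulA lmulC lmul1 lmulDl.

End LaurentRing.

Section LaurentMap.
Context (A B : zmodType) (phi : {additive A -> B}).

Fact lmap_bounded (f : laurent A) :
  exists N : nat, forall i : int, i < - N%:Z -> phi (f i) = 0.
Proof.
by have [N fN] := lcoef_bounded f; exists N => i /fN->; rewrite raddf0.
Qed.
Definition lmap (f : laurent A) : laurent B := Laurent (lmap_bounded f).

Fact lmap_is_zmod_morphism : zmod_morphism lmap.
Proof. by move=> f g; apply: laurentP => i /=; rewrite raddfB. Qed.

HB.instance Definition _ :=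
  GRing.isZmodMorphism.Build (laurent A) (laurent B) lmap lmap_is_zmod_morphism.

End LaurentMap.

Section LaurentRingMap.
Context (A B : comPzRingType) (phi : {rmorphism A -> B}).

Fact lmap_is_monoid_morphism : monoid_morphism (lmap phi).
Proof.
split=> [|f g]; apply: laurentP => k /=; first by rewrite rmorph_nat.
have [N N0] := lcoef_bounded3 f g 0.
have fN i : i < - N%:Z -> f i = 0 by case/N0.
have gN i : i < - N%:Z -> g i = 0 by case/N0.
rewrite !(lmul_coefE (a := - N%:Z) (n := (`|k| + 4 * N + 4)%N))//=.
- by rewrite rmorph_sum; apply: eq_bigr => i _; rewrite rmorphM.
- by move=> i iN; rewrite fN ?rmorph0.
- by move=> j jM; rewrite gN ?rmorph0//; lia.
- by move=> j jM; apply: gN; lia.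
Qed.

HB.instance Definition _ := GRing.isMonoidMorphism.Build
  (laurent A) (laurent B) (lmap phi) lmap_is_monoid_morphism.

End LaurentRingMap.

Section LaurentDeriv.
Context (A : zmodType).

Fact lderiv_bounded (f : laurent A) :
  exists N : nat, forall i : int, i < - N%:Z -> f (i + 1) *~ (i + 1) = 0.
Proof.
by have [N fN] := lcoef_bounded f; exists N.+1 => i iN; rewrite fN ?mul0rz//; lia.
Qed.
Definition lderiv (f : laurent A) : laurent A := Laurent (lderiv_bounded f).

Fact lderiv_is_zmod_morphism : zmod_morphism lderiv.
Proof. by move=> f g; apply: laurentP => i /=; rewrite mulrzBl. Qed.

HB.instance Definition _ := GRing.isZmodMorphism.Build
  (laurent A) (laurent A) lderiv lderiv_is_zmod_morphism.

End LaurentDeriv.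

(* [iterL A n] is A((t_1))...((t_n)): the outermost variable is t_n, and the
   variables t_1, ..., t_n are indexed by 0, ..., n - 1. [pderiv A n j] is the
   partial derivative with respect to the variable of index j. *)
Fixpoint iterL (A : comPzRingType) (n : nat) : comPzRingType :=
  if n is m.+1 then laurent (iterL A m) else A.

Fixpoint iterL_map (A B : comPzRingType) (phi : {rmorphism A -> B}) (n : nat) :
    {rmorphism iterL A n -> iterL B n} :=
  if n is m.+1 then lmap (iterL_map phi m) else phi.

Fixpoint pderiv (A : comPzRingType) (n j : nat) : {additive iterL A n -> iterL A n} :=
  if n is m.+1 return {additive iterL A n -> iterL A n} then
    if j == m then (@lderiv (iterL A m) : {additive laurent _ -> laurent _})
    else (lmap (pderiv A m j) : {additive laurent _ -> laurent _})
  else \0.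

(* The coefficient of t_1^(l 0) ... t_n^(l (n - 1)). *)
Fixpoint icoef (A : comPzRingType) (n : nat) : iterL A n -> (nat -> int) -> A :=
  if n is m.+1 then fun f l => icoef (f (l m)) l else fun a _ => a.

(* The inverse is carried along with the unit; it is determined by it. *)
Record units (R : comPzRingType) := Units {
  units_pair : R * R;
  _ : units_pair.1 * units_pair.2 == 1 }.

HB.instance Definition _ R := [isSub for @units_pair R].
HB.instance Definition _ R := [Choice of units R by <:].

Section Units.
Context (R : comPzRingType).
Implicit Types u v : units R.

Definition uval u : R := (units_pair u).1.
Definition uinv u : R := (units_pair u).2.

Lemma uvalV u : uval u * uinv u = 1.
Proof. by case: u => p p1; exact/eqP. Qed.

Lemma uval_inj : injective uval.
Proof.
move=> u v; have := uvalV u; have := uvalV v; rewrite /uval /uinv.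
case: u v => [[a b] ab] [[c d] cd] /= cd1 ab1 ac; apply: val_inj => /=.
by rewrite -{}ac in cd cd1 *; rewrite -[b]mulr1 -cd1 mulrCA mulrA ab1 mul1r.
Qed.

Fact umul_subproof u v : (uval u * uval v) * (uinv u * uinv v) == 1.
Proof. by rewrite mulrACA !uvalV mulr1. Qed.
Definition umul u v : units R := @Units R (_, _) (umul_subproof u v).

End Units.

Section UnitsMap.
Context (R R' : comPzRingType) (phi : {rmorphism R -> R'}).

Fact umap_subproof (u : units R) : phi (uval u) * phi (uinv u) == 1.
Proof. by rewrite -rmorphM uvalV rmorph1. Qed.
Definition umap (u : units R) : units R' := @Units R' (_, _) (umap_subproof u).

Lemma umapM : {morph umap : u v / umul u v}.
Proof. by move=> u v; apply: uval_inj; exact: rmorphM. Qed.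

End UnitsMap.

Section GeneratedSubgroup.
Context (V : zmodType) (G : set V).

Definition gen_zmod : {pred V} := fun x =>
  `[< forall H : {pred V}, zmod_closed H -> (forall g, G g -> g \in H) -> x \in H >].

Fact gen_zmod_closed : zmod_closed gen_zmod.
Proof.
split; first by apply/asboolP => H [].
move=> x y /asboolP xG /asboolP yG; apply/asboolP => H HV GH.
by apply: (HV.2); [apply: xG|apply: yG].
Qed.

HB.instance Definition _ := GRing.isZmodClosed.Build V gen_zmod gen_zmod_closed.

Definition qzmod := Quotient.quot gen_zmod.
HB.instance Definition _ := GRing.Zmodule.on qzmod.

Definition qpi (x : V) : qzmod := (\pi_(Quotient.quot gen_zmod) x)%qT.
Definition qrepr (x : qzmod) : V := repr (x : Quotient.quot gen_zmod).

Fact qpi_is_zmod_morphism : zmod_morphism qpi.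
Proof. exact: (raddfB (\pi_(Quotient.quot gen_zmod)%qT)). Qed.
HB.instance Definition _ :=
  GRing.isZmodMorphism.Build V qzmod qpi qpi_is_zmod_morphism.

Lemma qreprK : cancel qrepr qpi.
Proof. exact: reprK. Qed.

Lemma gen_zmodP x : G x -> x \in gen_zmod.
Proof. by move=> Gx; apply/asboolP => H _; apply. Qed.

Lemma qpi_eq x y : (qpi x == qpi y) = (x - y \in gen_zmod).
Proof. by rewrite Quotient.idealrBE. Qed.

Lemma qpi_eq0 x : G x -> qpi x = 0.
Proof.
by move=> Gx; apply/eqP; rewrite -(raddf0 qpi) qpi_eq subr0 gen_zmodP.
Qed.

Lemma gen_zmod_ker (W : zmodType) (h : {additive V -> W}) :
  (forall g, G g -> h g = 0) -> forall x, x \in gen_zmod -> h x = 0.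
Proof.
move=> hG x /asboolP/(_ [pred x | h x == 0]) xG; apply/eqP/xG => [|g /hG/eqP//].
split=> [|y z]; rewrite !inE ?raddf0// => /eqP hy /eqP hz.
by rewrite raddfB hy hz subr0.
Qed.

Lemma qrepr_qpi (W : zmodType) (h : {additive V -> W}) :
  (forall g, G g -> h g = 0) -> forall x, h (qrepr (qpi x)) = h x.
Proof.
move=> hG x; apply/eqP; rewrite -subr_eq0 -raddfB; apply/eqP/gen_zmod_ker => //.
by rewrite -qpi_eq qreprK.
Qed.

End GeneratedSubgroup.

Section Milnor.
Context (m : nat) (R : comPzRingType).

Definition upd (f : {ffun 'I_m -> units R}) (k : 'I_m) (u : units R) :
    {ffun 'I_m -> units R} :=
  [ffun i => if i == k then u else f i].

(* The m-th tensor power over Z of the abelian group R^*: the free abelian group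
   on m-tuples of units modulo multilinearity. *)
Definition multilinear_rel : set {freeg {ffun 'I_m -> units R}} :=
  [set g | exists f k u v,
     g = << upd f k (umul u v) >> - << upd f k u >> - << upd f k v >> ].

Definition tpow : zmodType := qzmod multilinear_rel.

Definition tpure (f : {ffun 'I_m -> units R}) : tpow := qpi _ << f >>.

(* Tensors with entries a and 1 - a, both units, at two consecutive positions. *)
Definition steinberg_rel : set tpow :=
  [set x | exists (f : {ffun 'I_m -> units R}) (i j : 'I_m),
     [/\ j = i.+1 :> nat, uval (f j) = 1 - uval (f i) & x = tpure f] ].

Definition KM : zmodType := qzmod steinberg_rel.

Definition symb (f : {ffun 'I_m -> units R}) : KM := qpi _ (tpure f).

End Milnor.

Section MilnorMap.
Context (m : nat) (R R' : comPzRingType) (phi : {rmorphism R -> R'}).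

Definition tuple_map (f : {ffun 'I_m -> units R}) : {ffun 'I_m -> units R'} :=
  [ffun i => umap phi (f i)].

Lemma tuple_map_upd f k u :
  tuple_map (upd f k u) = upd (tuple_map f) k (umap phi u).
Proof. by apply/ffunP => i; rewrite !ffunE; case: eqP. Qed.

Definition freeg_map : {freeg {ffun 'I_m -> units R}} -> tpow m R' :=
  fun x => qpi _ (fglift (fun f => << tuple_map f >>) x).

Fact freeg_map_is_zmod_morphism : zmod_morphism freeg_map.
Proof. by move=> x y; rewrite /freeg_map lift_is_additive raddfB. Qed.
HB.instance Definition _ :=
  GRing.isZmodMorphism.Build _ _ freeg_map freeg_map_is_zmod_morphism.

Lemma freeg_mapU f : freeg_map << f >> = tpure (tuple_map f).
Proof. by rewrite /freeg_map liftU scale1r. Qed.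

Lemma freeg_map_rel g : multilinear_rel g -> freeg_map g = 0.
Proof.
move=> [f [k [u [v ->]]]]; rewrite !raddfB/= !freeg_mapU !tuple_map_upd umapM.
by rewrite /tpure -!raddfB; apply: qpi_eq0; exists (tuple_map f), k, (umap phi u), (umap phi v).
Qed.

Definition tpow_map (x : tpow m R) : tpow m R' := freeg_map (qrepr x).

Lemma tpow_map_pi x : tpow_map (qpi _ x) = freeg_map x.
Proof. by rewrite /tpow_map (qrepr_qpi freeg_map_rel). Qed.

Fact tpow_map_is_zmod_morphism : zmod_morphism tpow_map.
Proof.
by move=> x y; rewrite -(qreprK x) -(qreprK y) -raddfB !tpow_map_pi raddfB.
Qed.
HB.instance Definition _ :=
  GRing.isZmodMorphism.Build _ _ tpow_map tpow_map_is_zmod_morphism.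

Lemma tpow_map_pure f : tpow_map (tpure f) = tpure (tuple_map f).
Proof. by rewrite /tpure tpow_map_pi freeg_mapU. Qed.

Definition tpow_KM (x : tpow m R) : KM m R' := qpi _ (tpow_map x).
Fact tpow_KM_is_zmod_morphism : zmod_morphism tpow_KM.
Proof. by move=> x y; rewrite /tpow_KM !raddfB. Qed.
HB.instance Definition _ :=
  GRing.isZmodMorphism.Build _ _ tpow_KM tpow_KM_is_zmod_morphism.

Lemma tpow_KM_rel x : steinberg_rel x -> tpow_KM x = 0.
Proof.
move=> [f [i [j [ij fij ->]]]]; rewrite /tpow_KM tpow_map_pure.
apply: qpi_eq0; exists (tuple_map f), i, j; split=> //.
rewrite !ffunE; have /= := congr1 phi fij.
by rewrite rmorphB rmorph1.
Qed.

Definition KM_map (x : KM m R) : KM m R' := tpow_KM (qrepr x).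

Lemma KM_map_pi x : KM_map (qpi _ x) = qpi _ (tpow_map x).
Proof. by rewrite /KM_map (qrepr_qpi tpow_KM_rel). Qed.

Fact KM_map_is_zmod_morphism : zmod_morphism KM_map.
Proof.
move=> x y; rewrite -(qreprK x) -(qreprK y) -raddfB !KM_map_pi.
by rewrite !raddfB.
Qed.
HB.instance Definition _ :=
  GRing.isZmodMorphism.Build _ _ KM_map KM_map_is_zmod_morphism.

Lemma KM_map_symb f : KM_map (symb f) = symb (tuple_map f).
Proof. by rewrite /symb KM_map_pi tpow_map_pure. Qed.

End MilnorMap.

Section Forms.
Context (R : comPzRingType) (n : nat).

(* The exterior algebra of the free R-module on dt_1, ..., dt_n, in the basis
   indexed by the subsets I of the index set: I = {i_1 < ... < i_k} stands for
   dt_(i_1) /\ ... /\ dt_(i_k). *)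
Definition form := {ffun {set 'I_n} -> R}.

Definition dt (j : 'I_n) : form := [ffun I : {set 'I_n} => (I == [set j]%SET)%:R].

Definition fone : form := [ffun I : {set 'I_n} => (I == finset.set0)%:R].

Definition fscale (a : R) (w : form) : form := [ffun I => a * w I].

(* dt_I /\ dt_J = (-1)^(inversions I J) dt_(I :|: J) for disjoint I and J. *)
Definition inversions (I J : {set 'I_n}) : nat :=
  #|[set p : 'I_n * 'I_n | [&& p.1 \in I, p.2 \in J & (p.2 < p.1)%N]]|.

Definition wedge (w1 w2 : form) : form :=
  [ffun K : {set 'I_n} => \sum_(I : {set 'I_n} | I \subset K)
     (-1) ^+ inversions I (K :\: I) * (w1 I * w2 (K :\: I)%SET)].

End Forms.

Section Residue.
Context (A : comPzRingType) (n : nat).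

Definition fdiff (f : iterL A n) : form (iterL A n) n :=
  \sum_(j < n) fscale (pderiv A n j f) (dt _ j).

Definition dlog (u : units (iterL A n)) : form (iterL A n) n :=
  fscale (uinv u) (fdiff (uval u)).

Definition residue (w : form (iterL A n) n) : A :=
  icoef (w [set: 'I_n]%SET) (fun=> -1).

End Residue.

(* The i-th ghost coordinate; only i > 0 is meaningful. *)
Definition ghost (A : comPzRingType) (w : nat -> A) (i : nat) : A :=
  \sum_(d <- divisors i) w d ^+ (i %/ d) *+ d.

Section GhostSolve.
Context (R : comNzRingType).
Implicit Types (f g h : {poly R}) (x y t : nat -> R) (n : nat).

Let eqm n f g := forall k, (k <= n)%N -> f`_k = g`_k.

Let eqmM n f f' g g' : eqm n f f' -> eqm n g g' -> eqm n (f * g) (f' * g').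
Proof.
move=> ff' gg' k kn; rewrite !coefM; apply: eq_bigr => i _.
by rewrite ff' ?gg'//; have := ltn_ord i; lia.
Qed.

Let eqmD n f f' g g' : eqm n f f' -> eqm n g g' -> eqm n (f + g) (f' + g').
Proof. by move=> ff' gg' k kn; rewrite !coefD ff' ?gg'. Qed.

Let eqm_deriv n f g : eqm n f g -> eqm n ('X * f^`()) ('X * g^`()).
Proof. by move=> fg [|k] kn; rewrite !coefXM//= !coef_deriv fg. Qed.

Let eqm_inv n f : f`_0 = 1 -> exists u, eqm n (f * u) 1.
Proof.
move=> f0; exists (\sum_(i < n.+1) (1 - f) ^+ i) => k kn.
have -> : f * \sum_(i < n.+1) (1 - f) ^+ i = 1 - (1 - f) ^+ n.+1.
  have := subrXX 1 (1 - f) n.+1; rewrite expr1n => ->.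
  rewrite subKr; congr (_ * _).
  by apply: eq_bigr => i _; rewrite expr1n mul1r.
have /factor_theorem[h ->] : root (1 - f) 0.
  by rewrite /root horner_coef0 coefB f0 coef1 subrr.
by rewrite polyC0 subr0 exprMn coefB coefMXn ltnS kn subr0.
Qed.

Let LD n f g := eqm n (g * f) (- ('X * f^`())).

Let LD1 n : LD n 1 0.
Proof. by rewrite /LD mul0r -polyC1 derivC mulr0 oppr0. Qed.

Let LDM n f1 g1 f2 g2 : LD n f1 g1 -> LD n f2 g2 -> LD n (f1 * f2) (g1 + g2).
Proof.
move=> h1 h2; rewrite /LD derivM.
have -> : (g1 + g2) * (f1 * f2) = g1 * f1 * f2 + g2 * f2 * f1 by ring.
have -> : - ('X * (f1^`() * f2 + f1 * f2^`())) =
    - ('X * f1^`()) * f2 + - ('X * f2^`()) * f1 by ring.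
apply: eqmD; [apply: (eqmM h1)|apply: (eqmM h2)]. all: by [].
Qed.

Let LD_eqm n f f' g : eqm n f f' -> LD n f g -> LD n f' g.
Proof.
move=> ff' fg k kn; have gf : eqm n (g * f) (g * f') by apply: eqmM.
by rewrite -gf// fg// !coefN (eqm_deriv ff').
Qed.

Let LD_uniq n f g g' : f`_0 = 1 -> LD n f g -> LD n f g' -> eqm n g g'.
Proof.
move=> /(eqm_inv n)[u fu] fg fg' k kn.
have gE h : eqm n h (h * f * u).
  move=> j jn; have hh : eqm n (h * 1) (h * (f * u)).
    by apply: eqmM => // l ln; rewrite fu.
  by rewrite -mulrA -hh// mulr1.
rewrite (gE g)// (gE g')//.
by apply: (@eqmM n) => // j jn; rewrite fg// fg'.
Qed.

Let lam x n : {poly R} := \prod_(d < n) (1 - x d.+1 *: 'X^(d.+1)).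

Let lam0 x n : (lam x n)`_0 = 1.
Proof.
rewrite -horner_coef0 horner_prod big1// => d _.
by rewrite !hornerE expr0n/= mulr0 subr0.
Qed.

Let gpoly x n : {poly R} := \poly_(k < n.+1) (if k == 0%N then 0 else ghost x k).

Let gpolyE x n k : (0 < k <= n)%N -> (gpoly x n)`_k = ghost x k.
Proof. by move=> /andP[k0 kn]; rewrite coef_poly ltnS kn gtn_eqF. Qed.

Let LD_lam x n : LD n (lam x n) (gpoly x n).
Proof.
pose G d : {poly R} := \sum_(j < n) (x d ^+ j.+1 *+ d) *: 'X^(d * j.+1).
have LDd m : LD n (\prod_(d < m) (1 - x d.+1 *: 'X^(d.+1))) (\sum_(d < m) G d.+1).
  elim: m => [|m IHm]; first by rewrite !big_ord0.
  rewrite !big_ord_recr/=; apply: LDM => //.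
  rewrite /LD /G derivB -polyC1 derivC sub0r derivZ derivXn/=.
  pose u j : {poly R} := (x m.+1 ^+ j *+ m.+1) *: 'X^(m.+1 * j).
  have -> : (\sum_(j < n) (x m.+1 ^+ j.+1 *+ m.+1) *: 'X^(m.+1 * j.+1)) *
      (1 - x m.+1 *: 'X^(m.+1)) = u 1 - u n.+1.
    rewrite -[RHS]opprB -(telescope_sumr u (ltn0Sn n)) big_add1/= big_mkord mulr_suml.
    rewrite -sumrN; apply: eq_bigr => j _.
    rewrite opprB mulrBr mulr1 -scalerAl -scalerAr scalerA -exprD /u.
    rewrite mulrnAl -exprSr; congr (_ - _ *: 'X^_); lia.
  move=> k kn; rewrite coefB [(u n.+1)`_k]coefZ coefXn (_ : k == _ = false) ?mulr0 ?subr0.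
    have -> : - ('X * - (x m.+1 *: ('X^m *+ m.+1))) = u 1%N.
      by rewrite mulrN opprK /u muln1 expr1 exprS -scalerAr mulrnAr -scalerMnr scalerMnl.
    by [].
  by apply/negbTE; nia.
have GE k : (k <= n)%N -> (gpoly x n)`_k = (\sum_(d < n) G d.+1)`_k.
  move=> kn; rewrite coef_sum.
  under eq_bigr => d _ do rewrite coef_sum.
  case: k kn => [|k] kn.
    rewrite coef_poly/= big1// => d _; rewrite big1// => j _.
    by rewrite coefZ coefXn mulnS mulr0.
  rewrite gpolyE// /ghost (perm_big [seq d <- index_iota 1 n.+1 | (d %| k.+1)%N])/=; last first.
    apply: uniq_perm; rewrite ?divisors_uniq ?filter_uniq ?iota_uniq// => d.
    rewrite mem_filter mem_index_iota -dvdn_divisors//; case: (boolP (d %| _)%N) => // dk.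
    by have := dvdn_leq (ltn0Sn k) dk; have := dvdn_gt0 (ltn0Sn k) dk; lia.
  rewrite big_filter big_add1/= big_mkord [RHS](bigID (fun d : 'I_n => (d.+1 %| k.+1)%N))/=.
  rewrite [X in _ + X]big1 ?addr0 => [|d /negP dk]; last first.
    rewrite big1// => j _; rewrite coefZ coefXn (_ : _ == _ = false) ?mulr0//.
    by apply/negbTE/eqP => kE; apply: dk; rewrite kE dvdn_mulr.
  apply: eq_bigr => d /dvdnP[q kE].
  have q0 : (0 < q)%N by case: q kE.
  have qn : (q.-1 < n)%N by nia.
  rewrite (bigD1 (Ordinal qn))//= big1 ?addr0 => [|j jq].
    by rewrite coefZ coefXn prednK// mulnC -kE eqxx mulr1 kE mulnK.
  rewrite coefZ coefXn (_ : _ == _ = false) ?mulr0//; apply/negbTE.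
  apply: contra jq => /eqP kE'; apply/eqP/val_inj => /=; nia.
by move=> k kn; rewrite -(LDd n)//; apply: (@eqmM n).
Qed.

Let lamS x n : lam x n.+1 = lam x n * (1 - x n.+1 *: 'X^(n.+1)).
Proof. by rewrite /lam big_ord_recr. Qed.

Let lam_surj n f : f`_0 = 1 -> exists t, eqm n (lam t n) f.
Proof.
move=> f0; elim: n => [|n [t tf]].
  by exists (fun=> 0) => k; rewrite leqn0 => /eqP->; rewrite lam0.
pose c := (lam t n)`_n.+1 - f`_n.+1.
pose t' d := if d == n.+1 then c else t d.
have lt' : lam t' n = lam t n.
  by apply: eq_bigr => d _; rewrite /t' (_ : _ == _ = false)//; have := ltn_ord d; lia.
exists t' => k; rewrite lamS lt' mulrBr mulr1 coefB -scalerAr coefZ coefMXn.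
rewrite leq_eqVlt => /orP[/eqP->|].
  by rewrite ltnn subnn lam0 mulr1 /t' eqxx subKr.
by rewrite ltnS => kn; rewrite kn mulr0 subr0 tf.
Qed.

Let ghost_lam t n f g : f`_0 = 1 -> eqm n (lam t n) f -> LD n f g ->
  forall k, (0 < k <= n)%N -> ghost t k = g`_k.
Proof.
move=> f0 tf fg k kn; rewrite -(gpolyE t kn).
by apply: (LD_uniq f0 (LD_eqm tf (@LD_lam t n)) fg); case/andP: kn.
Qed.

Lemma ghost_add_solve x y n : exists t, forall k, (0 < k <= n)%N ->
  ghost t k = ghost x k + ghost y k.
Proof.
have f0 : (lam x n * lam y n)`_0 = 1 by rewrite coef0M !lam0 mulr1.
have [t tf] := lam_surj n f0; exists t => k kn.
rewrite (ghost_lam f0 tf (LDM (@LD_lam x n) (@LD_lam y n)) kn).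
by rewrite coefD !gpolyE.
Qed.

Lemma ghost_opp_solve x n : exists t, forall k, (0 < k <= n)%N ->
  ghost t k = - ghost x k.
Proof.
have [u xu] := eqm_inv n (lam0 x n).
have u0 : u`_0 = 1.
  by have := xu 0%N (leq0n n); rewrite coef0M lam0 mul1r coef1.
have [t tu] := lam_surj n u0; exists t => k kn.
have tx : eqm n (lam t n * lam x n) 1.
  by move=> j jn; rewrite -xu// mulrC; apply: (@eqmM n).
have tx1 := LD_eqm tx (LDM (@LD_lam t n) (@LD_lam x n)).
have := LD_uniq _ tx1 (@LD1 n); rewrite coef1 => /(_ erefl k).
case/andP: (kn) => _ -> /(_ isT) /eqP.
by rewrite coefD !gpolyE// coef0 addr_eq0 => /eqP.
Qed.

End GhostSolve.

Section GhostTheory.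

Lemma ghost_rmorph (A B : comPzRingType) (phi : {rmorphism A -> B}) x i :
  phi (ghost x i) = ghost (fun d => phi (x d)) i.
Proof.
by rewrite rmorph_sum; apply: eq_bigr => d _; rewrite rmorphMn/= rmorphXn.
Qed.

Lemma eq_ghost (A : comPzRingType) (x y : nat -> A) i : (0 < i)%N ->
  (forall d, (d %| i)%N -> x d = y d) -> ghost x i = ghost y i.
Proof.
by move=> i0 xy; apply: eq_big_seq => d; rewrite -dvdn_divisors// => /xy->.
Qed.

Lemma ghost_inj (A : comPzRingType) (x y : nat -> A) i :
    (forall (a : A) n, (0 < n)%N -> a *+ n = 0 -> a = 0) -> (0 < i)%N ->
    (forall d, (d %| i)%N -> ghost x d = ghost y d) ->
  forall d, (d %| i)%N -> x d = y d.
Proof.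
move=> tf i0 xy; elim/ltn_ind => d IHd di.
have d0 : (0 < d)%N by exact: dvdn_gt0 di.
have := xy d di; rewrite /ghost !(bigD1_seq d)/= ?divisors_uniq// -?dvdn_divisors//.
rewrite divnn d0 !expr1.
rewrite [X in x d *+ d + X](_ : _ = \sum_(e <- divisors d | e != d) y e ^+ (d %/ e) *+ e).
  move=> /addIr/eqP; rewrite -subr_eq0 -mulrnBl => /eqP/(tf _ _ d0)/eqP.
  by rewrite subr_eq0 => /eqP.
rewrite big_seq_cond [RHS]big_seq_cond; apply: eq_bigr => e /andP[].
rewrite -dvdn_divisors// => ed e'd; rewrite IHd//; last exact: dvdn_trans di.
by rewrite ltn_neqAle e'd dvdn_leq.
Qed.

End GhostTheory.

Section IntPoly.

Definition ipoly (n : nat) : comPzRingType := {mpoly int[n]}.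
Definition ivar (n : nat) (i : 'I_n) : ipoly n := 'X_i.

(* The value of an integral polynomial at a point of a commutative ring, which
   unlike for [mmap] may be the zero ring. *)
Definition zeval (n : nat) (A : comPzRingType) (p : ipoly n) (h : 'I_n -> A) : A :=
  \sum_(m <- msupp p) (\prod_(i < n) h i ^+ m i) *~ p@_m.

Lemma eq_zeval n (A : comPzRingType) (p : ipoly n) (h h' : 'I_n -> A) :
  h =1 h' -> zeval p h = zeval p h'.
Proof. by move=> /funext->. Qed.

Lemma zeval_rmorph n (A B : comPzRingType) (phi : {rmorphism A -> B})
    (p : ipoly n) (h : 'I_n -> A) :
  phi (zeval p h) = zeval p (fun i => phi (h i)).
Proof.
rewrite rmorph_sum; apply: eq_bigr => m _; rewrite rmorphMz rmorph_prod.
by congr (_ *~ _); apply: eq_bigr => i _; rewrite rmorphXn.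
Qed.

Lemma zevalX n (p : ipoly n) : zeval p (@ivar n) = p.
Proof.
rewrite [RHS]mpolyE; apply: eq_bigr => m _.
by rewrite -/(mmap1 _ _) mmap1_id -[in RHS](intz p@_m) scaler_int.
Qed.

Lemma zeval_unique n (A : comPzRingType) (phi : {rmorphism ipoly n -> A}) p :
  phi p = zeval p (fun i => phi (ivar i)).
Proof. by rewrite -[in LHS](zevalX p) zeval_rmorph. Qed.

Lemma zeval_ex n (A : comPzRingType) (h : 'I_n -> A) :
  exists phi : {rmorphism ipoly n -> A}, forall i, phi (ivar i) = h i.
Proof.
have [A0|A1] := eqVneq (1 : A) 0.
  have a0 (a b : A) : a = b by rewrite -[a]mul1r -[b]mul1r A0 !mul0r.
  pose f (_ : ipoly n) : A := 0.
  have fB : zmod_morphism f by move=> x y; exact: a0.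
  have fM : monoid_morphism f by split=> [|x y]; exact: a0.
  pose fz := GRing.isZmodMorphism.Build _ _ f fB.
  pose fm := GRing.isMonoidMorphism.Build _ _ f fM.
  pose phi : {rmorphism ipoly n -> A} := HB.pack f fz fm.
  by exists phi => i; exact: a0.
pose nzA := GRing.PzSemiRing_isNonZero.Build A A1.
pose A' : comNzRingType := HB.pack (GRing.ComPzRing.sort A) nzA.
pose phi : {rmorphism {mpoly int[n]} -> A'} := mmap (intr : int -> A') (h : 'I_n -> A').
by exists phi => i; rewrite /phi/= mmapX mmap1U.
Qed.

Lemma ipoly_tf n (p : ipoly n) k : (0 < k)%N -> p *+ k = 0 -> p = 0.
Proof.
move=> k0 pk; apply/mpolyP => m; have := congr1 (mcoeff m) pk.
by rewrite mcoeffMn !mcoeff0 => /eqP; rewrite mulrn_eq0 gtn_eqF//= => /eqP.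
Qed.

End IntPoly.

(* A family of polynomials, the i-th one in Z[x_0, ..., x_i, y_0, ..., y_i]. *)
Definition law := forall i : nat, ipoly (i.+1 + i.+1).

Definition law_env (A : comPzRingType) (x y : nat -> A) (i : nat) (k : 'I_(i.+1 + i.+1)) : A :=
  match split k with inl d => x d | inr d => y d end.

Definition law_eval (s : law) (A : comPzRingType) (x y : nat -> A) (i : nat) : A :=
  zeval (s i) (law_env x y (i := i)).

Definition is_add_law (s : law) := forall (A : comPzRingType) (x y : nat -> A) (i : nat),
  (0 < i)%N -> ghost (law_eval s x y) i = ghost x i + ghost y i.

(* The negation of x, as a law that does not depend on y. *)
Definition is_opp_law (s : law) := forall (A : comPzRingType) (x y : nat -> A) (i : nat),
  (0 < i)%N -> ghost (law_eval s x y) i = - ghost x i.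

Section LawTheory.

Lemma law_eval_rmorph s (A B : comPzRingType) (phi : {rmorphism A -> B}) x y i :
  phi (law_eval s x y i) = law_eval s (fun d => phi (x d)) (fun d => phi (y d)) i.
Proof.
rewrite zeval_rmorph; apply: eq_zeval => k.
by rewrite /law_env; case: (split k).
Qed.

Lemma eq_law_eval s (A : comPzRingType) (x x' y y' : nat -> A) i :
    (forall d, (d <= i)%N -> x d = x' d) -> (forall d, (d <= i)%N -> y d = y' d) ->
  law_eval s x y i = law_eval s x' y' i.
Proof.
move=> xx' yy'; apply: eq_zeval => k; rewrite /law_env.
by case: (split k) => d; [apply: xx'|apply: yy']; rewrite -ltnS.
Qed.

Let genx N (d : nat) : ipoly (N.+1 + N.+1) := ivar (lshift N.+1 (inord d : 'I_N.+1)).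
Let geny N (d : nat) : ipoly (N.+1 + N.+1) := ivar (rshift N.+1 (inord d : 'I_N.+1)).

Let gen_env N : law_env (genx N) (geny N) (i := N) =1 @ivar _.
Proof.
move=> k; rewrite /law_env /genx /geny; case: (splitP k) => d kd.
  by rewrite (_ : lshift _ _ = k)//; apply: val_inj; rewrite /= inordK.
by rewrite (_ : rshift _ _ = k)//; apply: val_inj; rewrite /= inordK.
Qed.

Let gen_ex N (A : comPzRingType) (x y : nat -> A) :
  exists phi : {rmorphism ipoly (N.+1 + N.+1) -> A},
    (forall d, (d <= N)%N -> phi (genx N d) = x d) /\
    (forall d, (d <= N)%N -> phi (geny N d) = y d).
Proof.
have [phi phiE] := zeval_ex (law_env x y (i := N)); exists phi.
split=> d dN; rewrite phiE /law_env.
  case: splitP => e /=; rewrite inordK// => dE; last by lia.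
  by rewrite dE.
case: splitP => e /=; rewrite inordK// => dE; first by have := ltn_ord e; lia.
by move/addnI: dE => ->.
Qed.

Let law_exists (a b : int) :
    (forall (R : comNzRingType) (x y : nat -> R) n, exists t,
      forall k, (0 < k <= n)%N -> ghost t k = ghost x k *~ a + ghost y k *~ b) ->
  exists s : law, forall (A : comPzRingType) (x y : nat -> A) i, (0 < i)%N ->
    ghost (law_eval s x y) i = ghost x i *~ a + ghost y i *~ b.
Proof.
move=> ex; have {ex} [t tE] : exists t : forall N, nat -> ipoly (N.+1 + N.+1),
    forall N k, (0 < k <= N)%N ->
    ghost (t N) k = ghost (genx N) k *~ a + ghost (geny N) k *~ b.
  exists (fun N => sval (cid (ex _ (genx N) (geny N) N))) => N k kN.
  by case: (cid _) => /= u; apply.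
exists (fun i => t i i) => A x y i i0.
have [phi [phix phiy]] := gen_ex i x y.
have dleq d k : (0 < k)%N -> (d %| k)%N -> (0 < d <= k)%N.
  by move=> k0 dk; rewrite (dvdn_gt0 k0 dk) dvdn_leq.
have lhsE : phi (ghost (t i) i) = ghost x i *~ a + ghost y i *~ b.
  rewrite tE; last by rewrite i0 leqnn.
  rewrite (rmorphD phi) !(rmorphMz phi).
  by congr (_ *~ _ + _ *~ _); rewrite ghost_rmorph; apply: eq_ghost => // d;
    move=> /(dleq _ _ i0)/andP[_ ?]; [apply: phix|apply: phiy].
rewrite -lhsE (ghost_rmorph phi (t i)); apply: eq_ghost => // d di.
have /andP[d0 dlei] := dleq _ _ i0 di.
have [g [gx gy]] := gen_ex d (genx i) (geny i).
have tg : forall e, (e %| d)%N -> t i e = g (t d e).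
  apply: (@ghost_inj _ (t i) (fun e => g (t d e)) d _ d0) => [|e' /(dleq _ _ d0) e'd]; first exact: ipoly_tf.
  rewrite -[RHS](ghost_rmorph g (t d)) (tE i); last by lia.
  rewrite (tE d)// (rmorphD g) !(rmorphMz g).
  have le_e'd c : (c %| e')%N -> (c <= d)%N by move=> /dvdn_leq; lia.
  by congr (_ *~ _ + _ *~ _); rewrite ghost_rmorph; apply/esym/eq_ghost => [|c];
    [lia|move=> /le_e'd; apply: gx|lia|move=> /le_e'd; apply: gy].
rewrite tg// (zeval_unique g) zeval_rmorph; apply: eq_zeval => k.
rewrite -gen_env /law_env; case: (split k) => e.
  by rewrite gx -1?ltnS// phix//; have := ltn_ord e; lia.
by rewrite gy -1?ltnS// phiy//; have := ltn_ord e; lia.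
Qed.

Lemma add_law_exists : exists s, is_add_law s.
Proof.
have [|s sE] := @law_exists 1 1; last by exists s => A x y i /sE->; rewrite !mulr1z.
move=> R x y n; have [t tE] := ghost_add_solve x y n.
by exists t => k /tE->; rewrite !mulr1z.
Qed.

Lemma opp_law_exists : exists s, is_opp_law s.
Proof.
have [|s sE] := @law_exists (-1) 0.
  move=> R x y n; have [t tE] := ghost_opp_solve x n.
  by exists t => k /tE->; rewrite mulrN1z mulr0z addr0.
by exists s => A x y i /sE->; rewrite mulrN1z mulr0z addr0.
Qed.

Lemma add_law_unique s s' : is_add_law s -> is_add_law s' ->
  forall i, (0 < i)%N -> s i = s' i.
Proof.
move=> sP s'P i i0; have sE (r : law) : r i = law_eval r (genx i) (geny i) i.
  by rewrite /law_eval (eq_zeval _ (@gen_env i)) zevalX.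
rewrite (sE s) (sE s').
have := @ghost_inj _ (law_eval s (genx i) (geny i)) (law_eval s' (genx i) (geny i)) i.
move=> /(_ (@ipoly_tf _) i0); apply; last exact: dvdnn.
by move=> d di; have d0 := dvdn_gt0 i0 di; rewrite (sP _ _ _ _ d0) (s'P _ _ _ _ d0).
Qed.

End LawTheory.

(* [tset S] is a set of positive integers closed under taking divisors. *)
Record truncset := TruncSet {
  tset :> nat -> Prop;
  tset_gt0 : forall i, tset i -> (0 < i)%N;
  tset_dvd : forall i d, tset i -> (d %| i)%N -> tset d }.

Definition add_law : law := sval (cid add_law_exists).
Definition opp_law : law := sval (cid opp_law_exists).

Lemma add_lawP : is_add_law add_law.
Proof. exact: (svalP (cid add_law_exists)). Qed.

Lemma opp_lawP : is_opp_law opp_law.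
Proof. exact: (svalP (cid opp_law_exists)). Qed.

Section WittSeq.

Inductive wterm :=
  WVar of 'I_3 | WZero | WAdd of wterm & wterm | WOpp of wterm.

Fixpoint winterp (A : comPzRingType) (e : 'I_3 -> nat -> A) (t : wterm) : nat -> A :=
  match t with
  | WVar k => e k
  | WZero => fun=> 0
  | WAdd t1 t2 => law_eval add_law (winterp e t1) (winterp e t2)
  | WOpp t1 => law_eval opp_law (winterp e t1) (winterp e t1)
  end.

Fixpoint ginterp (V : zmodType) (g : 'I_3 -> V) (t : wterm) : V :=
  match t with
  | WVar k => g k
  | WZero => 0
  | WAdd t1 t2 => ginterp g t1 + ginterp g t2
  | WOpp t1 => - ginterp g t1
  end.

Lemma ghost0 (A : comPzRingType) i : (0 < i)%N -> ghost (fun=> 0 : A) i = 0.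
Proof.
move=> i0; rewrite /ghost big_seq big1// => d; rewrite -dvdn_divisors// => di.
have : (0 < i %/ d)%N by rewrite divn_gt0 ?(dvdn_gt0 i0 di)// dvdn_leq.
by rewrite expr0n lt0n => /negbTE->; rewrite mul0rn.
Qed.

Lemma ghost_winterp (A : comPzRingType) (e : 'I_3 -> nat -> A) t i : (0 < i)%N ->
  ghost (winterp e t) i = ginterp (fun k => ghost (e k) i) t.
Proof.
move=> i0; elim: t => [//||t1 IH1 t2 IH2|t1 IH1] /=; first exact: ghost0.
  by rewrite add_lawP// IH1 IH2.
by rewrite opp_lawP// IH1.
Qed.

Lemma winterp_rmorph (A B : comPzRingType) (phi : {rmorphism A -> B}) e t i :
  phi (winterp e t i) = winterp (fun k d => phi (e k d)) t i.
Proof.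
elim: t i => [//||t1 IH1 t2 IH2|t1 IH1] i /=; first exact: rmorph0.
  by rewrite law_eval_rmorph; apply: eq_law_eval => d _.
by rewrite law_eval_rmorph; apply: eq_law_eval => d _.
Qed.

Lemma eq_winterp (A : comPzRingType) (e e' : 'I_3 -> nat -> A) t i :
    (forall k d, (d <= i)%N -> e k d = e' k d) ->
  winterp e t i = winterp e' t i.
Proof.
elim: t i => [k|//|t1 IH1 t2 IH2|t1 IH1] i ee' /=; first exact: ee'.
  by apply: eq_law_eval => d di; [apply: IH1|apply: IH2] => k c cd;
    apply: ee'; exact: leq_trans di.
by apply: eq_law_eval => d di; apply: IH1 => k c cd; apply: ee'; exact: leq_trans di.
Qed.

Let restr (A : comPzRingType) (e : 'I_3 -> nat -> A) i k d :=
  if (d %| i)%N then e k d else 0.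

Let winterp_restr t1 t2 (A : comPzRingType) (e : 'I_3 -> nat -> A) i :
    (forall (V : zmodType) (g : 'I_3 -> V), ginterp g t1 = ginterp g t2) -> (0 < i)%N ->
  winterp e t1 i = winterp (restr e i) t2 i.
Proof.
move=> t12 i0; pose N := (3 * i.+1)%N.
pose h (m : 'I_N.+1) : A := e (inord (m %% 3)) (m %/ 3)%N.
have [phi phiE] := zeval_ex h.
have [E phiEE] : exists E : 'I_3 -> nat -> ipoly N.+1,
    forall k d, (d <= i)%N -> phi (E k d) = e k d.
  exists (fun k d => ivar (inord (d * 3 + k))) => k d di.
  have k3 := ltn_ord k; rewrite phiE /h inordK; last by rewrite /N; lia.
  by rewrite modnMDl divnMDl// modn_small// divn_small// addn0 inord_val.
have EE : forall d, (d %| i)%N -> winterp E t1 d = winterp (restr E i) t2 d.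
  apply: (@ghost_inj _ (winterp E t1) (winterp (restr E i) t2) i _ i0) => [|d di].
    exact: ipoly_tf.
  have d0 := dvdn_gt0 i0 di.
  apply: etrans (ghost_winterp E t1 d0) _.
  apply: etrans (t12 _ _) (etrans _ (esym (ghost_winterp (restr E i) t2 d0))).
  apply: (congr1 (fun g => ginterp g t2)); apply: funext => k.
  by apply: (eq_ghost d0) => c cd; rewrite /restr (dvdn_trans cd di).
have /(congr1 phi) := EE i (dvdnn i); rewrite !winterp_rmorph => EEi.
transitivity (winterp (fun k d => phi (E k d)) t1 i).
  by apply: eq_winterp => k d di; rewrite phiEE.
rewrite {}EEi; apply: eq_winterp => k d di; rewrite /restr.
by case: ifP => _; rewrite ?phiEE ?rmorph0.
Qed.

Lemma winterp_eq t1 t2 (A : comPzRingType) (e1 e2 : 'I_3 -> nat -> A) i :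
    (forall (V : zmodType) (g : 'I_3 -> V), ginterp g t1 = ginterp g t2) ->
    (0 < i)%N -> (forall k d, (d %| i)%N -> e1 k d = e2 k d) ->
  winterp e1 t1 i = winterp e2 t2 i.
Proof.
move=> t12 i0 e12; rewrite (winterp_restr _ t12)// [RHS](@winterp_restr t2 t2)//.
apply: eq_winterp => k d di; rewrite /restr.
by case: ifP => // /e12->.
Qed.

End WittSeq.

Definition witt (S : truncset) (A : comPzRingType) := {i : nat | S i} -> A.

Section Witt.
Context (S : truncset) (A : comPzRingType).
Implicit Types w v : witt S A.

(* The coordinates of w, extended by 0 outside S. *)
Definition wcoord w (i : nat) : A :=
  if pselect (S i) is left Si then w (exist _ i Si) else 0.

(* For i in S, the sum defining [ghost] only involves coordinates in S. *)
Definition wghost w (i : nat) : A := ghost (wcoord w) i.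

Definition wzero : witt S A := fun=> 0.
Definition wadd w v : witt S A :=
  fun i => law_eval add_law (wcoord w) (wcoord v) (sval i).
Definition wopp w : witt S A :=
  fun i => law_eval opp_law (wcoord w) (wcoord w) (sval i).

Lemma wcoordE w i : wcoord w (sval i) = w i.
Proof.
rewrite /wcoord; case: pselect => [Si|]; last by case: i.
by congr w; case: i Si => i Si Si'; congr exist; exact: Prop_irrelevance.
Qed.

Lemma wcoord_wadd w v i : S i ->
  wcoord (wadd w v) i = law_eval add_law (wcoord w) (wcoord v) i.
Proof. by move=> Si; rewrite (wcoordE (wadd w v) (exist _ i Si)). Qed.

Lemma wcoord_wopp w i : S i ->
  wcoord (wopp w) i = law_eval opp_law (wcoord w) (wcoord w) i.
Proof. by move=> Si; rewrite (wcoordE (wopp w) (exist _ i Si)). Qed.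

Lemma wcoord_wzero i : wcoord wzero i = 0.
Proof. by rewrite /wcoord; case: pselect. Qed.

Let env (x y z : nat -> A) : 'I_3 -> nat -> A :=
  fun k => nth (fun=> 0) [:: x; y; z] k.
Let X := WVar (inord 0).
Let Y := WVar (inord 1).
Let Z := WVar (inord 2).

Let envX x y z : env x y z (inord 0) = x. Proof. by rewrite /env inordK. Qed.
Let envY x y z : env x y z (inord 1) = y. Proof. by rewrite /env inordK. Qed.
Let envZ x y z : env x y z (inord 2) = z. Proof. by rewrite /env inordK. Qed.

Lemma eq_add_law (x x' y y' : nat -> A) i : (0 < i)%N ->
    (forall d, (d %| i)%N -> x d = x' d) -> (forall d, (d %| i)%N -> y d = y' d) ->
  law_eval add_law x y i = law_eval add_law x' y' i.
Proof.
move=> i0 xx' yy'.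
have := @winterp_eq (WAdd X Y) (WAdd X Y) A (env x y x) (env x' y' x') i.
rewrite /= !envX !envY; apply=> // k d di.
by rewrite /env; case: k => -[|[|[|]]]//= _; [apply: xx'|apply: yy'|apply: xx'].
Qed.

Fact waddA : associative wadd.
Proof.
move=> w v u; apply: funext => -[i Si]; rewrite /wadd /=.
have i0 := tset_gt0 Si.
rewrite (eq_add_law (x' := wcoord w)
    (y' := law_eval add_law (wcoord v) (wcoord u)))//; last first.
  by move=> d di; rewrite wcoord_wadd//; exact: tset_dvd di.
rewrite [RHS](eq_add_law (y' := wcoord u)
    (x' := law_eval add_law (wcoord w) (wcoord v)))//; last first.
  by move=> d di; rewrite wcoord_wadd//; exact: tset_dvd di.
have := @winterp_eq (WAdd X (WAdd Y Z)) (WAdd (WAdd X Y) Z) A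
  (env (wcoord w) (wcoord v) (wcoord u)) (env (wcoord w) (wcoord v) (wcoord u)) i.
by rewrite /= !envX !envY !envZ; apply=> // V g /=; rewrite addrA.
Qed.

Fact waddC : commutative wadd.
Proof.
move=> w v; apply: funext => -[i Si]; rewrite /wadd /=.
have := @winterp_eq (WAdd X Y) (WAdd Y X) A
  (env (wcoord w) (wcoord v) (wcoord v)) (env (wcoord w) (wcoord v) (wcoord v)) i.
rewrite /= !envX !envY; apply=> //; last exact: tset_gt0 Si.
by move=> V g /=; rewrite addrC.
Qed.

Fact wadd0 : left_id wzero wadd.
Proof.
move=> w; apply: funext => -[i Si]; rewrite /wadd -[RHS]wcoordE/=.
rewrite (_ : wcoord wzero = fun=> 0); last by apply: funext => d; exact: wcoord_wzero.
have := @winterp_eq (WAdd WZero X) X A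
  (env (wcoord w) (wcoord w) (wcoord w)) (env (wcoord w) (wcoord w) (wcoord w)) i.
rewrite /= !envX; apply=> //; last exact: tset_gt0 Si.
by move=> V g /=; rewrite add0r.
Qed.

Fact waddN : left_inverse wzero wopp wadd.
Proof.
move=> w; apply: funext => -[i Si]; rewrite /wadd /=.
have i0 := tset_gt0 Si.
rewrite (eq_add_law (y' := wcoord w)
    (x' := law_eval opp_law (wcoord w) (wcoord w)))//; last first.
  by move=> d di; rewrite wcoord_wopp//; exact: tset_dvd di.
have := @winterp_eq (WAdd (WOpp X) X) WZero A
  (env (wcoord w) (wcoord w) (wcoord w)) (env (wcoord w) (wcoord w) (wcoord w)) i.
by rewrite /= !envX; apply=> // V g /=; rewrite addNr.
Qed.

HB.instance Definition _ := gen_eqMixin (witt S A).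
HB.instance Definition _ := gen_choiceMixin (witt S A).
HB.instance Definition _ :=
  GRing.isZmodule.Build (witt S A) waddA waddC wadd0 waddN.

Lemma wghostD w v i : S i -> wghost (w + v) i = wghost w i + wghost v i.
Proof.
move=> Si; have i0 := tset_gt0 Si; rewrite /wghost -add_lawP//.
by apply: eq_ghost => // d di; rewrite wcoord_wadd//; exact: tset_dvd di.
Qed.

End Witt.

Section WittMap.
Context (S : truncset) (A B : comPzRingType) (phi : {rmorphism A -> B}).

Definition witt_map (w : witt S A) : witt S B := fun i => phi (w i).

Lemma wcoord_map w i : wcoord (witt_map w) i = phi (wcoord w i).
Proof. by rewrite /wcoord; case: pselect => // _; rewrite rmorph0. Qed.

Lemma witt_mapD : {morph witt_map : w v / w + v}.
Proof.
move=> w v; apply: funext => i; rewrite /witt_map [LHS]law_eval_rmorph.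
by apply: eq_law_eval => d _; rewrite wcoord_map.
Qed.

End WittMap.

(* Main.v *)
(* The pairing is built from the expression in ghost coordinates
     const_coef (g(i) v^i \prod_k y_k^(i-1) det (t_j dy_k/dt_j)),
   which for v = \prod_k f_k^-1 and y = f is the required residue, but which makes
   sense for arbitrary series v, y_1, ..., y_n, not only for units.  Such data over A
   lift to a polynomial ring B over Z mapping onto A, whereas units would not.  Over B,
   which is torsion free and carries a Frobenius lift phi_p for each prime p, the
   expressions r_i are the ghost coordinates of a Witt vector by Dwork's criterion
   r_i = phi_p(r_(i/p)) modulo p^(v_p(i)).  These congruences are checked with the
   Frobenius lift of B((t_1))...((t_n)) that maps t_j to t_j^p: the error terms are
   residues of U dz /\ (closed forms) with dU divisible by p^(v_p(i)), and one
   integrates by parts.  The result does not depend on the lift, since two lifts over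
   B_1 and B_2 both come from a polynomial ring mapping onto the fibre product of B_1
   and B_2 over A.
   Additivity in g, the Leibniz rule for a product y_k = ab, and vanishing when
   y_l = 1 - y_k are identities between ghost coordinates of lifts; applied to units
   they yield bilinearity and the Steinberg relation. *)
From HB Require Import structures.
From mathcomp.multinomials Require Import monalg freeg.
From mathcomp Require Import all_boot all_order all_algebra all_fingroup.
From mathcomp Require Import finmap.
From mathcomp Require Import boolp classical_sets fsbigop.
From mathcomp Require Import zify ring.
Require Import Defs.

Set Implicit Arguments.
Unset Strict Implicit.
Unset Printing Implicit Defensive.

Import GRing.Theory Num.Theory.
Local Open Scope ring_scope.

(** * Congruences and Dwork's criterion *)

Definition ndvd (V : zmodType) (m : nat) (x : V) : Prop := exists z, x = z *+ m.

Definition torsion_free (V : zmodType) : Prop :=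
  forall (x : V) m, (0 < m)%N -> x *+ m = 0 -> x = 0.

Definition frobenius_lift (R : comPzRingType) (p : nat) (phi : R -> R) : Prop :=
  forall x, ndvd p (phi x - x ^+ p).

Section Divisibility.
Context (V : zmodType).
Implicit Types (x y : V) (m k : nat).

Lemma ndvd0 m : ndvd m (0 : V). Proof. by exists 0; rewrite mul0rn. Qed.

Lemma ndvdMn m x : ndvd m (x *+ m). Proof. by exists x. Qed.

Lemma ndvdD m x y : ndvd m x -> ndvd m y -> ndvd m (x + y).
Proof. by move=> [a ->] [b ->]; exists (a + b); rewrite mulrnDl. Qed.

Lemma ndvdN m x : ndvd m x -> ndvd m (- x).
Proof. by move=> [a ->]; exists (- a); rewrite mulNrn. Qed.

Lemma ndvd_trans m x y z : ndvd m (x - y) -> ndvd m (y - z) -> ndvd m (x - z).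
Proof. by move=> xy /(ndvdD xy); rewrite addrA subrK. Qed.

Lemma ndvd_sym m x y : ndvd m (x - y) -> ndvd m (y - x).
Proof. by move=> /ndvdN; rewrite opprB. Qed.

Lemma ndvd_sum m (I : Type) (r : seq I) (P : pred I) (F : I -> V) :
  (forall i, P i -> ndvd m (F i)) -> ndvd m (\sum_(i <- r | P i) F i).
Proof. by move=> mF; apply: big_ind => //; [exact: ndvd0|exact: ndvdD]. Qed.

Lemma ndvd_mulrn m x k : ndvd m x -> ndvd (m * k) (x *+ k).
Proof. by move=> [a ->]; exists a; rewrite mulrnA. Qed.

Lemma dvdn_ndvd m k x : (m %| k)%N -> ndvd k x -> ndvd m x.
Proof. by move=> /dvdnP[q ->] [a ->]; exists (a *+ q); rewrite mulrnA. Qed.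

Lemma ndvd_coprime_mul m k x : coprime m k -> ndvd m (x *+ k) -> ndvd m x.
Proof.
have [->|m0] := posnP m; first by rewrite /coprime gcd0n => /eqP->.
case: (egcdnP k m0) => a b ab _ + [y xk]; rewrite /coprime => /eqP mk1.
exists (x *+ a - y *+ b); rewrite mulrnBl -!mulrnA ab mk1 mulrnDr mulr1n.
by rewrite [(b * m)%N]mulnC [y *+ _]mulrnA -xk -mulrnA [(k * b)%N]mulnC addrAC subrr add0r.
Qed.

Lemma ndvd_coprime m k x : coprime m k -> ndvd m x -> ndvd k x -> ndvd (m * k) x.
Proof.
move=> mk [a xa] kx; have km : coprime k m by rewrite coprime_sym.
have /(ndvd_coprime_mul km)[b ab] : ndvd k (a *+ m) by rewrite -xa.
by exists b; rewrite xa ab -mulrnA mulnC.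
Qed.

(** Induction on [i]: the full power of the least prime factor is split off, and the two coprime
    parts are recombined. *)
Lemma ndvd_logn i x : (0 < i)%N ->
  (forall p, prime p -> (p %| i)%N -> ndvd (p ^ logn p i) x) -> ndvd i x.
Proof.
elim/ltn_ind: i => i IHi i0 ix.
have [i1|i1] := leqP i 1.
  by rewrite (_ : i = 1%N); [exists x; rewrite mulr1n|lia].
have p_prime := pdiv_prime i1; have pi := pdiv_dvd i.
have [m pm iE] := pfactor_coprime p_prime i0.
have m0 : (0 < m)%N by rewrite iE in i0; case: m i0 {iE pm}.
rewrite iE; apply: ndvd_coprime; [|apply: IHi => //|exact: ix].
- by rewrite coprime_sym coprime_pexpl// logn_gt0 mem_primes p_prime i0.
- rewrite [ltnRHS]iE ltn_Pmulr//; rewrite -(expn0 (pdiv i)) ltn_exp2l ?prime_gt1//.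
  by rewrite logn_gt0 mem_primes p_prime i0.
- move=> q q_prime qm; have := ix q q_prime; rewrite iE dvdn_mulr// => /(_ isT).
  rewrite lognM// ?expn_gt0 ?prime_gt0// => h; apply: dvdn_ndvd h.
  by rewrite dvdn_exp2l// leq_addr.
Qed.

End Divisibility.

Lemma ndvd_raddf (V W : zmodType) (f : {additive V -> W}) m x : ndvd m x -> ndvd m (f x).
Proof. by move=> [a ->]; exists (f a); rewrite raddfMn. Qed.

Section RingCongruences.
Context (R : comPzRingType).
Implicit Types (x y : R) (m k p : nat).

Lemma ndvd_mull m x y : ndvd m y -> ndvd m (x * y).
Proof. by move=> [a ->]; exists (x * a); rewrite mulrnAr. Qed.

Lemma ndvd_mulr m x y : ndvd m x -> ndvd m (x * y).
Proof. by move=> mx; rewrite mulrC; apply: ndvd_mull. Qed.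

Lemma ndvd_exp m x y k : ndvd m (x - y) -> ndvd m (x ^+ k - y ^+ k).
Proof. by move=> mxy; rewrite subrXX; apply: ndvd_mulr. Qed.

(** With [x = y + p^e z], the linear binomial term carries [p p^e], and the term in [z^j] with
    [j >= 2] carries [p^(e j)], where [e j >= e + 1] because [e > 0]. *)
Lemma ndvd_expp p e x y : (0 < e)%N -> ndvd (p ^ e) (x - y) ->
  ndvd (p ^ e.+1) (x ^+ p - y ^+ p).
Proof.
move=> e0 [z /eqP]; rewrite subr_eq => /eqP->; rewrite [z *+ _ + y]addrC exprDn.
rewrite big_ord_recl/= subn0 expr0 mulr1 bin0 mulr1n addrAC subrr add0r.
apply: ndvd_sum => -[j /= jp] _; rewrite -mulrnAr; apply: ndvd_mull.
rewrite exprMn_n -mulrnA; apply: dvdn_ndvd (ndvdMn _ _).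
rewrite /bump leq0n add1n; case: j jp => [|j] jp.
  by rewrite bin1 expn1 expnSr.
rewrite dvdn_mulr// -expnM dvdn_exp2l//; nia.
Qed.

Lemma ndvd_exp_pexp p e x y : ndvd p (x - y) ->
  ndvd (p ^ e.+1) (x ^+ (p ^ e) - y ^+ (p ^ e)).
Proof.
move=> pxy; elim: e => [|e IHe]; first by rewrite expn0 expn1 !expr1.
by rewrite [(p ^ e.+1)%N]expnSr !exprM; exact: ndvd_expp.
Qed.

Lemma ndvd_exprD p x y : prime p -> ndvd p ((x + y) ^+ p - (x ^+ p + y ^+ p)).
Proof.
move=> p_prime; have p0 := prime_gt0 p_prime; rewrite exprDn.
case: p p_prime p0 => // p p_prime _.
rewrite big_ord_recl big_ord_recr/= subn0 !expr0 mulr1 bin0 mulr1n.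
rewrite /bump leq0n add1n subnn binn mul1r mulr1n opprD addrACA subrr add0r addrK.
apply: ndvd_sum => -[j jp] _ /=; apply: dvdn_ndvd (ndvdMn _ _).
by apply: prime_dvd_bin; rewrite ?/bump//=; lia.
Qed.

End RingCongruences.

(** The elements at which [phi] is the [p]-th power modulo [p] are closed under sums, so a Frobenius
    lift need only be tested on additive generators. *)
Lemma ndvd_frobD (R : comPzRingType) (p : nat) (phi : {additive R -> R}) (x y : R) :
  prime p -> ndvd p (phi x - x ^+ p) -> ndvd p (phi y - y ^+ p) ->
  ndvd p (phi (x + y) - (x + y) ^+ p).
Proof.
move=> p_prime px py; rewrite raddfD.
apply: ndvd_trans (ndvd_sym (ndvd_exprD x y p_prime)).
by rewrite opprD addrACA; exact: ndvdD.
Qed.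

(** If [d] missed part of the [p]-power in [i], then [p] would divide [i / d], so [d] would divide
    [i / p]. *)
Lemma logn_div_dvdn p i d : prime p -> (0 < i)%N -> (p %| i)%N -> (d %| i)%N ->
  ~~ (d %| i %/ p)%N -> (p ^ logn p i %| d)%N.
Proof.
move=> p_prime i0 pi di; apply: contraR => pd.
have d0 := dvdn_gt0 i0 di; have p0 := prime_gt0 p_prime.
have [c iE] := dvdnP di; have c0 : (0 < c)%N by rewrite iE in i0; case: (c) i0.
suff /dvdnP[b cE] : (p %| c)%N.
  by rewrite iE cE mulnAC mulnK// dvdn_mull.
move: pd; rewrite pfactor_dvdn// iE lognM// -ltnNge -[X in (X < _)%N]add0n ltn_add2r.
by rewrite logn_gt0 mem_primes => /and3P[].
Qed.

Lemma divisors_filter i p : (0 < i)%N -> (0 < p)%N -> (p %| i)%N ->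
  perm_eq [seq d <- divisors i | (d %| i %/ p)%N] (divisors (i %/ p)).
Proof.
move=> i0 p0 pi; have ip0 : (0 < i %/ p)%N by rewrite divn_gt0// dvdn_leq.
apply: uniq_perm; rewrite ?filter_uniq ?divisors_uniq// => d.
rewrite mem_filter -!dvdn_divisors//; case: (boolP (d %| i %/ p)%N) => // /dvdn_trans.
by apply; exact: dvdn_div.
Qed.

(** * Ghost coordinates and Frobenius lifts *)

Section GhostFrobenius.
Context (R : comPzRingType) (p : nat) (phi : {rmorphism R -> R}).
Hypotheses (p_prime : prime p) (phiP : frobenius_lift p phi).

(** With [i = p^e m], the congruence between [x^p] and [phi x] modulo [p] gains a factor [p] from
    each of the remaining [e - 1] powers by [p]. *)
Lemma ndvd_exp_frob x i : (0 < i)%N -> (p %| i)%N ->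
  ndvd (p ^ logn p i) (x ^+ i - phi x ^+ (i %/ p)).
Proof.
move=> i0 pi; have e0 : (0 < logn p i)%N by rewrite logn_gt0 mem_primes p_prime i0.
have [m _ iE] := pfactor_coprime p_prime i0.
have ipE : (i %/ p = p ^ (logn p i).-1 * m)%N.
  rewrite [in LHS]iE -[in LHS](prednK e0) expnS mulnC -mulnA mulKn ?prime_gt0//.
rewrite [in X in x ^+ X]iE mulnC ipE.
rewrite -{1 2}(prednK e0) expnS -mulnA [x ^+ _]exprM.
rewrite [phi x ^+ _]exprM [x ^+ p ^+ _]exprM; apply: ndvd_exp.
by rewrite -expnS; apply: ndvd_exp_pexp; apply: ndvd_sym; exact: phiP.
Qed.

(** The necessary half of Dwork's criterion. A term with [d] dividing [i / p] is compared with the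
    same term of the lower ghost coordinate; for any other [d], the factor [d] alone carries the
    full [p]-part of [i]. *)
Lemma ndvd_ghost_frob (w : nat -> R) i : (0 < i)%N -> (p %| i)%N ->
  ndvd (p ^ logn p i) (ghost w i - phi (ghost w (i %/ p))).
Proof.
move=> i0 pi; have p0 := prime_gt0 p_prime; rewrite /ghost.
have ip0 : (0 < i %/ p)%N by rewrite divn_gt0// dvdn_leq.
rewrite rmorph_sum -(perm_big _ (divisors_filter i0 p0 pi)) big_filter/=.
rewrite (bigID (fun d => d %| i %/ p)%N)/= addrAC; apply: ndvdD.
  rewrite -sumrB; apply: ndvd_sum => d dip.
  have di : (d %| i)%N by apply: dvdn_trans dip (dvdn_div pi).
  have d0 := dvdn_gt0 i0 di.
  rewrite rmorphMn rmorphXn -mulrnBl.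
  have [c iE] := dvdnP di; have c0 : (0 < c)%N by rewrite iE in i0; case: (c) i0.
  have pc : (p %| c)%N.
    by move: dip; rewrite dvdn_divRL// iE mulnC dvdn_pmul2r.
  have -> : (i %/ p %/ d = c %/ p)%N by rewrite -divnMA mulnC divnMA iE mulnK.
  have -> : (i %/ d = c)%N by rewrite iE mulnK.
  rewrite [in logn p i]iE lognM// expnD.
  have := ndvd_mulrn d (ndvd_exp_frob (w d) c0 pc); apply: dvdn_ndvd.
  by rewrite dvdn_mul// pfactor_dvdnn.
rewrite big_seq_cond; apply: ndvd_sum => d /andP[]; rewrite -dvdn_divisors// => di dip.
by apply: dvdn_ndvd (ndvdMn _ _); exact: logn_div_dvdn.
Qed.

End GhostFrobenius.

Section Dwork.
Context (B : comPzRingType) (phi : nat -> {rmorphism B -> B}).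
Hypotheses (B_tf : torsion_free B)
  (phiP : forall p, prime p -> frobenius_lift p (phi p)).

(** Coordinates are found one at a time: the congruences at the primes dividing [i] make [r i] minus
    the contribution of the proper divisors divisible by [i], and the quotient is the new
    coordinate. *)
Lemma dwork (r : nat -> B) :
    (forall p i, prime p -> (0 < i)%N -> (p %| i)%N ->
      ndvd (p ^ logn p i) (r i - phi p (r (i %/ p)%N))) ->
  exists c : nat -> B, forall i, (0 < i)%N -> ghost c i = r i.
Proof.
move=> rP.
have ex n : exists c : nat -> B, forall i, (0 < i <= n)%N -> ghost c i = r i.
  elim: n => [|n [c cP]]; first by exists (fun=> 0) => i /andP[]; lia.
  pose c' d := if d == n.+1 then 0 else c d.
  have c'P i : (0 < i <= n)%N -> ghost c' i = r i.
    move=> /andP[i0 iN]; rewrite -cP ?i0//; apply: eq_ghost => // d /(dvdn_leq i0) di.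
    by rewrite /c' (_ : _ == _ = false)//; lia.
  have [|z zP] := @ndvd_logn B n.+1 (r n.+1 - ghost c' n.+1) isT.
    move=> p p_prime pn; have := ndvd_ghost_frob p_prime (phiP p_prime) c' (ltn0Sn n) pn.
    have p1 := prime_gt1 p_prime.
    have pn0 : (0 < n.+1 %/ p)%N by rewrite divn_gt0 ?prime_gt0// dvdn_leq.
    rewrite (c'P (n.+1 %/ p)%N); last by rewrite pn0 -ltnS ltn_Pdiv.
    by move/ndvd_sym; apply: ndvd_trans; exact: rP.
  exists (fun d => if d == n.+1 then z else c d) => i /andP[i0].
  rewrite leq_eqVlt => /orP[/eqP->{i i0}|iN].
    have /eqP := zP; rewrite subr_eq => /eqP->.
    rewrite /ghost !(bigD1_seq n.+1)/= ?divisors_uniq ?divisors_id//.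
    rewrite /c' eqxx divnn !expr1 mul0rn add0r; congr (_ + _).
    by apply: eq_bigr => d /negbTE->.
  rewrite -cP ?i0//; apply: eq_ghost => // d /(dvdn_leq i0) di.
  by rewrite (_ : _ == _ = false)//; lia.
(* The solutions up to [n] are chosen independently for each [n]; injectivity of the ghost map over
   the torsion-free [B] makes their diagonal a solution. *)
pose c n := sval (cid (ex n)); have cP n := svalP (cid (ex n)).
exists (fun i => c i i) => i i0; rewrite -(cP i) ?i0 ?leqnn//.
apply: eq_ghost => // d di; have d0 := dvdn_gt0 i0 di.
apply: (@ghost_inj _ (c d) (c i) d) => //.
move=> e ed; have e0 := dvdn_gt0 d0 ed; have led := dvdn_leq d0 ed.
by rewrite !cP ?e0//= (leq_trans led)// dvdn_leq.
Qed.

End Dwork.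

(** * Jacobian determinants *)

Lemma torsion_free_inj (V : zmodType) : torsion_free V ->
  forall m (x y : V), (0 < m)%N -> x *+ m = y *+ m -> x = y.
Proof.
move=> tf m x y m0 /eqP; rewrite -subr_eq0 -mulrnBl => /eqP/(tf _ _ m0)/eqP.
by rewrite subr_eq0 => /eqP.
Qed.

Definition derivation (R : comPzRingType) (D : R -> R) : Prop :=
  forall x y, D (x * y) = D x * y + x * D y.

Section Derivation.
Context (R : comPzRingType) (D : {additive R -> R}).
Hypothesis DM : derivation D.

Lemma derivation1 : D 1 = 0.
Proof.
by apply: (addrI (D 1)); rewrite addr0 -[in RHS](mulr1 1) DM mulr1 mul1r.
Qed.

Lemma derivationX x i : D (x ^+ i) = (x ^+ i.-1 * D x) *+ i.
Proof.
elim: i => [|i IHi]; first by rewrite expr0 derivation1 mulr0n.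
rewrite exprS DM IHi /= mulrC mulrS; congr (_ + _).
by case: i {IHi} => [|i]; rewrite ?mulr0n ?mulr0// mulrnAr mulrA -exprS.
Qed.

Lemma derivation_prod (I : eqType) (r : seq I) (P : pred I) (F : I -> R) : uniq r ->
  D (\prod_(l <- r | P l) F l) =
  \sum_(m <- r | P m) D (F m) * \prod_(l <- r | P l && (l != m)) F l.
Proof.
elim: r => [|x r IHr] /=; first by rewrite !big_nil derivation1.
move=> /andP[xr r_uniq]; rewrite !big_cons; have {}IHr := IHr r_uniq.
have sumE : \sum_(m <- r | P m) D (F m) * \prod_(l <- x :: r | P l && (l != m)) F l =
    (if P x then F x else 1) *
    \sum_(m <- r | P m) D (F m) * \prod_(l <- r | P l && (l != m)) F l.
  rewrite mulr_sumr big_seq_cond [RHS]big_seq_cond; apply: eq_bigr => m /andP[mr _].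
  rewrite big_cons (_ : x != m); last by apply: contraNneq xr => ->.
  by rewrite andbT; case: ifP => _; rewrite ?mul1r// mulrCA.
rewrite {}sumE; case: ifP => Px; last by rewrite IHr mul1r.
rewrite DM IHr; congr (_ * _ + _); rewrite eqxx andbF.
rewrite big_seq_cond [RHS]big_seq_cond; apply: eq_bigl => l.
case: (boolP (l \in r)) => //= lr; case: eqP lr xr => [->|]; last by rewrite andbT.
by move=> ->.
Qed.

(** Differentiating [d w_d^(i/d)] gives [i w_d^(i/d - 1) D w_d]. *)
Lemma derivation_ghost (w : nat -> R) i : (0 < i)%N -> ndvd i (D (ghost w i)).
Proof.
move=> i0; rewrite /ghost raddf_sum/= big_seq; apply: ndvd_sum => d.
rewrite -dvdn_divisors// => di; rewrite raddfMn/= derivationX -mulrnA divnK//.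
exact: ndvdMn.
Qed.

End Derivation.

Section Jacobian.
Context (R B : comPzRingType) (n : nat).
Context (theta : 'I_n -> {additive R -> R}) (rho : {additive R -> B}).
Hypotheses (R_tf : torsion_free R) (B_tf : torsion_free B).
Hypothesis thetaM : forall j, derivation (theta j).
Hypothesis thetaC : forall j k x, theta j (theta k x) = theta k (theta j x).
Hypothesis rho_theta : forall j x, rho (theta j x) = 0.
Implicit Types (u : 'I_n -> R) (a : R).

Definition jacobian u : 'M[R]_n := \matrix_(k, j) theta j (u k).

Definition replace u (k : 'I_n) a : 'I_n -> R := fun l => if l == k then a else u l.

(* The determinant of the gradients is the divergence of the vector field obtained
   by stripping the derivative off the k-th row; the terms with second derivatives
   cancel in pairs. *)
Lemma rho_det_jacobian u (k : 'I_n) : rho (\det (jacobian u)) = 0.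
Proof.
pose X m := \sum_(s : 'S_n) (-1) ^+ s *
  (theta (s k) (theta (s m) (u m)) * \prod_(l | (l != k) && (l != m)) theta (s l) (u l)).
have X0 m : m != k -> X m = 0.
  move=> mk; apply: (R_tf (m := 2)) => //; rewrite mulr2n; apply/eqP; rewrite addr_eq0.
  apply/eqP; rewrite /X [LHS](reindex_inj (mulgI (tperm k m)))/= -sumrN; apply: eq_bigr => s _.
  rewrite odd_permM odd_tperm eq_sym mk /= !permM tpermL tpermR thetaC.
  rewrite signrN mulNr; congr (- (_ * (_ * _))).
  apply: eq_bigr => l /andP[lk lm]; rewrite permM tpermD//; by rewrite eq_sym.
have -> : \det (jacobian u) =
    \sum_(s : 'S_n) theta (s k)
      ((-1) ^+ s * (u k * \prod_(l | l != k) theta (s l) (u l)))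
    - u k * \sum_(m | m != k) X m.
  rewrite /X exchange_big/= mulr_sumr -sumrB; apply: eq_bigr => s _.
  under eq_bigr => i _ do rewrite mxE.
  rewrite (bigD1 k)//= -mulr_sumr [X in _ = _ - X]mulrCA.
  have thetas x : theta (s k) ((-1) ^+ s * x) = (-1) ^+ s * theta (s k) x.
    by case: (odd_perm s); rewrite ?expr1 ?mulN1r ?raddfN// !mul1r.
  rewrite thetas -mulrBr; congr (_ * _).
  rewrite thetaM (derivation_prod (thetaM _)) ?index_enum_uniq//=.
  by rewrite addrK.
by rewrite [\sum_(m | m != k) X m]big1// mulr0 subr0 raddf_sum big1.
Qed.

(** [rho] kills the Jacobian determinant with [a * u k] in row [k], which the Leibniz rule splits
    into the two terms. *)
Lemma integration_by_parts u (k : 'I_n) a :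
  rho (a * \det (jacobian u)) = - rho (u k * \det (jacobian (replace u k a))).
Proof.
apply/eqP; rewrite -addr_eq0 -raddfD; apply/eqP.
rewrite -[RHS](rho_det_jacobian (replace u k (a * u k)) k); congr (rho _); apply/esym.
apply: (determinant_multilinear (i0 := k)).
- apply/rowP => j; rewrite !mxE /replace eqxx thetaM addrC; congr (_ + _).
  by rewrite mulrC.
- by apply/matrixP => l j; rewrite !mxE /replace ![lift k l == k]eq_sym (negbTE (neq_lift k l)).
- by apply/matrixP => l j; rewrite !mxE /replace ![lift k l == k]eq_sym (negbTE (neq_lift k l)).
Qed.

(** When [theta j] is [t_j d/dt_j], this is the coefficient of [w(i) \prod_k y_k^(i-1) dy_1 /\ ...
    /\ dy_n] on the wedge of the [dt_j / t_j]. *)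
Definition ghost_form (w : nat -> R) (y : 'I_n -> R) (i : nat) : R :=
  ghost w i * \prod_k y k ^+ i.-1 * \det (jacobian y).

Context (p : nat) (Phi : {rmorphism R -> R}) (phi : {rmorphism B -> B}).
Hypotheses (p_prime : prime p) (PhiP : frobenius_lift p Phi).
Hypothesis theta_Phi : forall j x, theta j (Phi x) = Phi (theta j x) *+ p.
Hypothesis rho_Phi : forall x, rho (Phi x) = phi (rho x).

Let det_scaled N (M : 'M[R]_n) : \det (\matrix_(k, j) (M k j *+ N)) = \det M *+ (N ^ n).
Proof.
rewrite (_ : \matrix_(_, _) _ = N%:R *: M); last first.
  by apply/matrixP => k j; rewrite !mxE mulr_natl.
by rewrite detZ -natrX mulr_natl.
Qed.

Let det_rows_scaled N (c : 'I_n -> R) (y : 'I_n -> R) :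
  (\prod_k c k * \det (jacobian y)) *+ (N ^ n) =
  \det (\matrix_(k, j) ((c k * theta j (y k)) *+ N)).
Proof.
rewrite -mulrnAr -det_scaled (_ : \prod_k c k = \det (diag_mx (\row_k c k))); last first.
  by rewrite det_diag; apply: eq_bigr => k _; rewrite mxE.
rewrite -det_mulmx mul_diag_mx; congr (\det _).
by apply/matrixP => k j; rewrite !mxE mulrnAr.
Qed.

(* The hypotheses say that the rows of M are exact, except that those other than k
   are so only after multiplication by N. *)
Let rho_det_exact N U z (k : 'I_n) (M : 'M[R]_n) (a : 'I_n -> R) : (0 < N)%N ->
    (forall l j, l != k -> M l j *+ N = theta j (a l)) ->
    (forall j, M k j = theta j z) ->
    (forall j, ndvd N (theta j U)) ->
  ndvd N (rho (U * \det M)).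
Proof.
move=> N0 Ma Mk /fin_all_exists[eta etaP].
(* [eta] is the gradient of [U] divided by [N]; integration by parts puts it in row [k] in place of
   the gradient of [z]. *)
pose M' : 'M[R]_n := \matrix_(l, j) (if l == k then eta j else M l j).
exists (- rho (z * \det M')); apply: (torsion_free_inj B_tf (m := N ^ n)).
  by rewrite expn_gt0 N0.
rewrite -raddfMn -mulrnAr -det_scaled.
rewrite (_ : \matrix_(_, _) _ = jacobian (replace a k (z *+ N))); last first.
  apply/matrixP => l j; rewrite !mxE /replace.
  by case: eqP => [->|/eqP lk]; rewrite ?Mk ?raddfMn ?Ma.
rewrite (integration_by_parts _ k) {1}/replace eqxx.
rewrite (_ : jacobian _ = \matrix_(l, j) (M' l j *+ N)); last first.
  apply/matrixP => l j; rewrite !mxE /replace.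
  by case: eqP => [_|/eqP lk]; rewrite ?etaP ?Ma.
rewrite det_scaled mulrnAl mulrnAr !raddfMn/= !mulNrn.
by rewrite mulrnAC.
Qed.

(** Write [i = N m] with [m] prime to [p], [q = i / p] and [y_k^i = Phi(y_k^q) + N z_k].
    Differentiating and dividing by [N] shows that [m] times row [k] at [i] is [m] times [Phi] of
    row [k] at [q] plus the gradient of [z_k]. These gradients are removed row by row, each error
    being integrated by parts; [m^n] is cancelled at the end. *)
Lemma ghost_form_frob w y i : (0 < i)%N -> (p %| i)%N ->
  ndvd (p ^ logn p i) (rho (ghost_form w y i) - phi (rho (ghost_form w y (i %/ p)))).
Proof.
move=> i0 pi; have p0 := prime_gt0 p_prime; have [m pm iE] := pfactor_coprime p_prime i0.
set N := (p ^ logn p i)%N; set q := (i %/ p)%N.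
have N0 : (0 < N)%N by rewrite expn_gt0 p0.
have m0 : (0 < m)%N by rewrite iE in i0; case: (m) i0.
have q0 : (0 < q)%N by rewrite divn_gt0// dvdn_leq.
have qp : (q * p = i)%N by rewrite divnK.
have /fin_all_exists[z zP] : forall k : 'I_n, exists z, y k ^+ i = Phi (y k ^+ q) + z *+ N.
  move=> k; have [x xP] := ndvd_exp_frob p_prime PhiP (y k) i0 pi.
  by exists x; rewrite -/N -xP rmorphXn addrC subrK.
pose X k j := Phi (y k ^+ q.-1 * theta j (y k)).
have rowE k j : (y k ^+ i.-1 * theta j (y k)) *+ m = X k j *+ m + theta j (z k).
  apply: (torsion_free_inj R_tf (m := N)) => //; rewrite -mulrnA -iE -derivationX//.
  rewrite zP raddfD theta_Phi derivationX// rmorphMn/= -mulrnA qp raddfMn.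
  by rewrite mulrnDl -mulrnA -iE.
have GE : rho (ghost_form w y i) *+ (m ^ n) =
    rho (ghost w i * \det (\matrix_(k, j) (X k j *+ m + theta j (z k)))).
  rewrite -raddfMn /ghost_form -mulrA -mulrnAr; congr (rho (_ * _)).
  by rewrite det_rows_scaled; congr (\det _); apply/matrixP => k j; rewrite !mxE rowE.
have GqE : phi (rho (ghost_form w y q)) *+ (m ^ n) =
    rho (Phi (ghost w q) * \det (\matrix_(k, j) (X k j *+ m))).
  rewrite -rho_Phi -raddfMn /ghost_form -mulrA rmorphM -mulrnAr; congr (rho (_ * _)).
  rewrite -rmorphMn det_rows_scaled -det_map_mx; congr (\det _).
  by apply/matrixP => k j; rewrite !mxE rmorphMn.
(* [Phi] contributes a factor [p] and the ghost coordinate of index [q] a factor [q]; their product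
   [i] is a multiple of [N]. *)
have NU j : ndvd N (theta j (Phi (ghost w q))).
  rewrite theta_Phi -raddfMn; apply: ndvd_raddf; have [x ->] := derivation_ghost (thetaM j) w q0.
  by rewrite -mulrnA qp; apply: dvdn_ndvd (ndvdMn _ _); rewrite [X in (_ %| X)%N]iE dvdn_mull.
set U := Phi (ghost w q) in GqE NU *.
(* [H t] interpolates: its first [t] rows have lost the gradient of [z k]. *)
pose H t : 'M[R]_n := \matrix_(k, j) (X k j *+ m + (if (k < t)%N then 0 else theta j (z k))).
have step t : (t <= n)%N -> ndvd N (rho (U * \det (H 0%N)) - rho (U * \det (H t))).
  elim: t => [|t IHt] tn; first by rewrite subrr; exact: ndvd0.
  apply: ndvd_trans (IHt (ltnW tn)) _; rewrite -raddfB -mulrBr.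
  pose k := Ordinal tn.
  pose M : 'M[R]_n := \matrix_(l, j) (if l == k then theta j (z k) else H t l j).
  rewrite (_ : \det (H t) - _ = \det M).
    pose a (l : 'I_n) := if (l < t)%N then Phi (y l ^+ q) else y l ^+ i.
    apply: (rho_det_exact (k := k) (z := z k) (a := a)) => // [l j lk|j]; last first.
      by rewrite !mxE eqxx.
    rewrite !mxE (negbTE lk) /a; case: ifP => lt.
      by rewrite addr0 theta_Phi derivationX// rmorphMn/= -!mulrnA qp -iE.
    by rewrite -rowE -mulrnA -iE -derivationX.
  apply/eqP; rewrite subr_eq; apply/eqP; rewrite -[\det M]mul1r -[\det (H t.+1)]mul1r.
  apply: (determinant_multilinear (i0 := k)).
  - apply/rowP => j; rewrite !mxE eqxx ltnn ltnSn addr0 !mul1r addrC //.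
  - by apply/matrixP => l j; rewrite !mxE ![lift k l == k]eq_sym (negbTE (neq_lift k l)).
  - apply/matrixP => l j; rewrite !mxE ltnS leq_eqVlt.
    rewrite (_ : (lift k l == t :> nat) = false)//.
    by apply: contraNF (neq_lift k l) => /eqP lt; apply/eqP/val_inj; exact: esym lt.
apply: (@ndvd_coprime_mul _ N (m ^ n)).
  by rewrite /N coprimeXl// coprimeXr.
rewrite mulrnBl GE GqE; apply: (@ndvd_trans _ _ _ (rho (U * \det (H 0%N)))).
  rewrite (_ : \matrix_(_, _) _ = H 0%N); last by apply/matrixP => k j; rewrite !mxE.
  rewrite -raddfB -mulrBl; apply: ndvd_raddf; apply: ndvd_mulr.
  exact: ndvd_ghost_frob.
have := step n (leqnn n); rewrite (_ : H n = \matrix_(k, j) (X k j *+ m))//.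
by apply/matrixP => k j; rewrite !mxE ltn_ord addr0.
Qed.

End Jacobian.

(** * Laurent series *)

Lemma intsum_scale (A : zmodType) (p : nat) (F : int -> A) : (0 < p)%N ->
    (forall i : int, ~~ (p%:Z %| i)%Z -> F i = 0) ->
  (\sum_(i \in [set: int]) F i = \sum_(i \in [set: int]) F (p%:Z * i))%classic.
Proof.
move=> p0 F0.
rewrite -(@fsbig_widen _ _ _ _ (range (fun i => p%:Z * i)))//; last first.
  move=> i [_ /= ir]; apply: F0; apply: contra_notN ir => /dvdzP[q ->].
  by exists q => //; rewrite mulrC.
rewrite fsbig_image// => x y _ _ /= /eqP.
by rewrite (inj_eq (mulfI _)) ?eqz_nat -?lt0n// => /eqP.
Qed.

Section LaurentZmodTheory.
Context (A : zmodType).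
Implicit Types f g : laurent A.

Lemma lcoefB f g k : (f - g) k = f k - g k. Proof. by []. Qed.
Lemma lcoefD f g k : (f + g) k = f k + g k. Proof. by []. Qed.

Lemma lcoefMn f m k : (f *+ m) k = f k *+ m.
Proof. by elim: m => [|m IHm]; rewrite ?mulr0n// !mulrS lcoefD IHm. Qed.

Lemma lcoef_sum (I : Type) (r : seq I) (P : pred I) (F : I -> laurent A) k :
  (\sum_(i <- r | P i) F i) k = \sum_(i <- r | P i) F i k.
Proof. by elim/big_rec2: _ => //= i x y _ <-. Qed.

Lemma laurent_torsion_free : torsion_free A -> torsion_free (laurent A).
Proof.
move=> tf f m m0 fm; apply: laurentP => k; apply: (tf _ m m0).
by rewrite -lcoefMn fm.
Qed.

Lemma ndvd_laurent m f : (forall k, ndvd m (f k)) -> ndvd m f.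
Proof.
move=> fm; have [N fN] := lcoef_bounded f.
(* In the presence of torsion the chosen quotient of 0 may be nonzero; forcing 0 below the bound of
   [f] keeps [z] a Laurent series. *)
pose z k : A := if k < - N%:Z then 0 else sval (cid (fm k)).
have z0 : exists N : nat, forall i : int, i < - N%:Z -> z i = 0.
  by exists N => i iN; rewrite /z iN.
exists (Laurent z0); apply: laurentP => k; rewrite lcoefMn /= /z.
by case: ifP => [/fN->|_]; [rewrite mul0rn|exact: svalP (cid (fm k))].
Qed.

Fact lmono_bounded (a : A) (m : int) :
  exists N : nat, forall i : int, i < - N%:Z -> (if i == m then a else 0) = 0.
Proof. by exists `|m|%N => i im; rewrite (_ : i == m = false)//; lia. Qed.
Definition lmono (a : A) (m : int) : laurent A := Laurent (lmono_bounded a m).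

(** Agreement with a finite sum of monomials below [M] reduces additive questions about one
    coefficient to monomials. *)
Lemma lmono_split f (M : int) : exists (N : nat) (L : nat),
  forall k, k < M ->
    (f - \sum_(j < L) lmono (f (- N%:Z + j%:Z)) (- N%:Z + j%:Z)) k = 0.
Proof.
have [N fN] := lcoef_bounded f; exists N, (N + `|M|)%N => k kM.
rewrite lcoefB lcoef_sum; have [kN|kN] := boolP (k < - N%:Z).
  rewrite fN// big1 ?subr0// => j _ /=.
  by rewrite (_ : k == _ = false)//; lia.
have jL : (absz (k + N%:Z)%R < N + absz M)%N by lia.
rewrite (bigD1 (Ordinal jL))//= big1 => [|j jk].
  by rewrite addr0 (_ : - N%:Z + _ = k) ?eqxx ?subrr//; lia.
rewrite (_ : k == _ = false)//; apply: contraNF jk => /eqP kE.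
by apply/eqP/val_inj => /=; lia.
Qed.

Fact leuler_bounded f : exists N : nat, forall i : int, i < - N%:Z -> f i *~ i = 0.
Proof. by have [N fN] := lcoef_bounded f; exists N => i /fN->; rewrite mul0rz. Qed.
(** This is [t d/dt]. It preserves exponents, so its values have no constant coefficient, and it
    picks up exactly a factor [p] under [t -> t^p]. *)
Definition leuler f : laurent A := Laurent (leuler_bounded f).

Fact leuler_is_zmod_morphism : zmod_morphism leuler.
Proof. by move=> f g; apply: laurentP => i /=; rewrite mulrzBl. Qed.
HB.instance Definition _ := GRing.isZmodMorphism.Build
  (laurent A) (laurent A) leuler leuler_is_zmod_morphism.

End LaurentZmodTheory.

Section LaurentRingTheory.
Context (A : comPzRingType).
Implicit Types f g : laurent A.

Lemma lcoef_bounded2 f g : exists N : nat, forall i : int, i < - N%:Z ->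
  f i = 0 /\ g i = 0.
Proof. by have [N N0] := lcoef_bounded3 f g g; exists N => i /N0[]. Qed.

(* A uniform way of writing the coefficients of several products as finite sums. *)
Lemma lcoefM f g (k : int) (N M : nat) :
    (forall i : int, i < - N%:Z -> f i = 0 /\ g i = 0) -> (`|k| + 2 * N <= M)%N ->
  (f * g) k = \sum_(j < M.+1) f (- N%:Z + j%:Z) * g (k - (- N%:Z + j%:Z)).
Proof.
move=> fg kM; apply: lmul_coefE => [i /fg[]//|j jM].
by have [|_ ->] := fg j; [lia|].
Qed.

Lemma lcoef_mono_mul (a : A) m f k : (lmono a m * f) k = a * f (k - m).
Proof.
have [N fN] := lcoef_bounded f; rewrite [LHS](lmul_coefE (a := m) (n := (`|k - m| + N).+1)).
- rewrite big_ord_recl /= addr0 eqxx big1 ?addr0// => j _.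
  by rewrite (_ : _ == m = false) ?mul0r//; rewrite /bump /=; lia.
- by move=> i im /=; rewrite (_ : i == m = false)//; lia.
- by move=> j jk; apply: fN; lia.
Qed.

Lemma lmonoM (a b : A) m m' : lmono a m * lmono b m' = lmono (a * b) (m + m').
Proof.
apply: laurentP => k; rewrite lcoef_mono_mul /= -(inj_eq (addrI m)) addrC subrK.
by case: eqP => _; rewrite ?mulr0.
Qed.

Lemma lmono1 : lmono (1 : A) 0 = 1.
Proof. by apply: laurentP => k /=; case: eqP. Qed.

Lemma lmonoX (a : A) m n : lmono a m ^+ n = lmono (a ^+ n) (m * n%:Z).
Proof.
elim: n => [|n IHn]; first by rewrite !expr0 mulr0 lmono1.
by rewrite !exprS IHn lmonoM; congr lmono; lia.
Qed.

Lemma lmonoN (a b : A) m : lmono (a - b) m = lmono a m - lmono b m.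
Proof. by apply: laurentP => k; rewrite lcoefB /=; case: eqP; rewrite ?subr0. Qed.

Lemma lcoefM_order f g (M N : int) :
    (forall i, i < M -> f i = 0) -> (forall i, i < N -> g i = 0) ->
  forall i, i < M + N -> (f * g) i = 0.
Proof.
move=> fM gN i iMN; rewrite [LHS](lmul_coefE (a := M) (n := 0)) ?big_ord0// => j jM.
by apply: gN; lia.
Qed.

Lemma lcoefX_order f (M : int) n :
  (forall i, i < M -> f i = 0) -> forall i, i < M * n%:Z -> (f ^+ n) i = 0.
Proof.
move=> fM; elim: n => [|n IHn] i iMn.
  by rewrite expr0 /= (_ : i == 0 = false)//; lia.
by rewrite exprS; apply: lcoefM_order fM IHn _ _; lia.
Qed.

Lemma leuler_derivation : derivation (@leuler A).
Proof.
move=> f g; apply: laurentP => k; have [N fg] := lcoef_bounded2 f g.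
have fg' (i : int) : i < - N%:Z -> leuler f i = 0 /\ leuler g i = 0.
  by move=> /fg[/= -> ->]; rewrite !mul0rz.
change ((f * g) k *~ k = (leuler f * g) k + (f * leuler g) k).
rewrite !(lcoefM (N := N) (M := (`|k| + 2 * N)%N))//.
- rewrite -big_split/= mulrz_suml; apply: eq_bigr => j _.
  by rewrite mulrzAl mulrzAr -mulrzDr; congr (_ *~ _); lia.
- by move=> i iN; have [? _] := fg i iN; have [] := fg' i iN.
- by move=> i iN; have [_ ?] := fg i iN; have [] := fg' i iN.
Qed.

Lemma lmap_derivation (D : {additive A -> A}) : derivation D -> derivation (lmap D).
Proof.
move=> DM f g; apply: laurentP => k; have [N fg] := lcoef_bounded2 f g.
have fg' (i : int) : i < - N%:Z -> lmap D f i = 0 /\ lmap D g i = 0.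
  by move=> /fg[/= -> ->]; rewrite !raddf0.
change (D ((f * g) k) = (lmap D f * g) k + (f * lmap D g) k).
rewrite !(lcoefM (N := N) (M := (`|k| + 2 * N)%N))//.
- by rewrite raddf_sum -big_split/=; apply: eq_bigr => j _; rewrite DM.
- by move=> i iN; have [? _] := fg i iN; have [] := fg' i iN.
- by move=> i iN; have [_ ?] := fg i iN; have [] := fg' i iN.
Qed.

Section Frobenius.
Context (p : nat) (phi : {rmorphism A -> A}).
Hypothesis p_gt0 : (0 < p)%N.

Fact lfrob_bounded f : exists N : nat, forall i : int, i < - N%:Z ->
  (if (p%:Z %| i)%Z then phi (f (i %/ p)%Z) else 0) = 0.
Proof.
have [N fN] := lcoef_bounded f; exists (p * N)%N => i iN.
by case: ifP => // /dvdzP[q iE]; rewrite fN ?rmorph0// iE mulzK; nia.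
Qed.
(** The substitution [t -> t^p] combined with [phi] on the coefficients. *)
Definition lfrob f : laurent A := Laurent (lfrob_bounded f).

Lemma lfrobE f (k : int) : lfrob f (p%:Z * k) = phi (f k).
Proof. by rewrite /= dvdz_mulr// mulrC mulzK//; lia. Qed.

Lemma lfrobN f (k : int) : ~~ (p%:Z %| k)%Z -> lfrob f k = 0.
Proof. by move=> /negbTE /= ->. Qed.

Lemma lfrobP f g : (forall k, g (p%:Z * k) = phi (f k)) ->
  (forall k, ~~ (p%:Z %| k)%Z -> g k = 0) -> lfrob f = g.
Proof.
move=> gp g0; apply: laurentP => k; have [/dvdzP[q ->]|pk] := boolP (p%:Z %| k)%Z.
  by rewrite mulrC lfrobE gp.
by rewrite lfrobN// g0.
Qed.

Lemma lfrobB : zmod_morphism lfrob.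
Proof.
move=> f g; apply: lfrobP => k => [|pk]; rewrite lcoefB ?lfrobE ?rmorphB//.
by rewrite !lfrobN// subr0.
Qed.

Lemma lfrobM : monoid_morphism lfrob.
Proof.
split=> [|f g].
  apply: lfrobP => k => [|pk] /=.
    by rewrite mulf_eq0 (_ : p%:Z == 0 = false)/= ?rmorph_nat//; lia.
  by rewrite (_ : k == 0 = false)//; apply: contraNF pk => /eqP->; exact: dvdz0.
apply: lfrobP => k => [|pk]; rewrite [LHS]/= /lmul_coef.
  rewrite (intsum_scale p_gt0) => [|i pi]; last by rewrite lfrobN ?mul0r.
  have [N fg] := lcoef_bounded2 f g.
  rewrite (lcoefM (N := N) (M := (`|k| + 2 * N)%N))// rmorph_sum.
  rewrite (intsumE (a := - N%:Z) (n := (`|k| + 2 * N).+1)).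
    by apply: eq_bigr => j _; rewrite rmorphM -mulrBr !lfrobE.
  move=> i iN; rewrite -mulrBr !lfrobE -rmorphM.
  have [iN'|iN'] := boolP (i < - N%:Z).
    by have [-> _] := fg i iN'; rewrite mul0r rmorph0.
  by have [|_ ->] := fg (k - i); [lia|rewrite mulr0 rmorph0].
rewrite (intsum_scale p_gt0) => [|i pi]; last by rewrite lfrobN ?mul0r.
under eq_fsbigr => i _.
  rewrite [lfrob g _]lfrobN ?mulr0.
    over.
  by apply: contra pk => pk; rewrite -[k](subrK (p%:Z * i)) rpredD// dvdz_mulr.
by rewrite fsbig1.
Qed.

Definition lfrob_rmorphism : {rmorphism laurent A -> laurent A} :=
  HB.pack lfrob (GRing.isZmodMorphism.Build _ _ lfrob lfrobB)
    (GRing.isMonoidMorphism.Build _ _ lfrob lfrobM).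

Lemma lfrob_lmono a m : lfrob (lmono a m) = lmono (phi a) (m * p%:Z).
Proof.
apply: lfrobP => k => [|pk] /=.
  rewrite mulrC (inj_eq (mulIf _)); last by lia.
  by case: eqP => // _; rewrite rmorph0.
by rewrite (_ : k == _ = false)//; apply: contraNF pk => /eqP->; exact: dvdz_mull.
Qed.

(** Coefficients are treated one at a time. A tail [h] of order above [|k|] affects coefficient [k]
    neither of [lfrob (P + h)] nor, modulo [p], of [(P + h)^p]; the remaining [P] is a finite sum of
    monomials. *)
Lemma lfrob_lift : prime p -> frobenius_lift p phi -> frobenius_lift p lfrob.
Proof.
move=> p_prime phiP f; apply: ndvd_laurent => k.
pose good g := ndvd p (lfrob g - g ^+ p).
have goodD g h : good g -> good h -> good (g + h).
  by move=> gg gh; apply: (ndvd_frobD (phi := lfrob_rmorphism)).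
have good0 : good 0.
  rewrite /good; have /= -> := raddf0 lfrob_rmorphism.
  by rewrite expr0n gtn_eqF// subr0; exact: ndvd0.
have goodmono a m : good (lmono a m).
  rewrite /good lfrob_lmono lmonoX -lmonoN; have [z ->] := phiP a.
  exists (lmono z (m * p%:Z)); apply: laurentP => i; rewrite lcoefMn /=.
  by case: eqP; rewrite ?mul0rn.
have [N [L fP]] := lmono_split f (`|k| + 1)%N.
set P := \sum_(j < L) _ in fP.
have goodP : good P by rewrite /P; elim/big_ind: _.
have [h [-> {}fP]] : exists h, f = P + h /\ forall i, i < (`|k| + 1)%N%:Z -> h i = 0.
  by exists (f - P); rewrite addrC subrK.
have hp i : i < p%:Z * (`|k| + 1)%N%:Z -> (h ^+ p) i = 0.
  by move=> ip; apply: (lcoefX_order fP); lia.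
have lh : lfrob h k = 0.
  rewrite /=; case: ifP => // /dvdzP[q kE]; rewrite kE mulzK; last by lia.
  by rewrite fP ?rmorph0//; nia.
have [z zP] := goodP; have [z' z'P] := ndvd_exprD P h p_prime.
have lD : lfrob (P + h) = lfrob P + lfrob h := raddfD lfrob_rmorphism P h.
rewrite lcoefB {}lD.
have -> : (P + h) ^+ p = P ^+ p + h ^+ p + z' *+ p by rewrite -z'P [RHS]addrC subrK.
have -> : lfrob P = z *+ p + P ^+ p by rewrite -zP subrK.
exists (z k - z' k); rewrite !lcoefD lh hp; last by nia.
rewrite !lcoefMn !addr0 opprD addrA addrK mulrnBl //.
Qed.

End Frobenius.

End LaurentRingTheory.

(** * Iterated Laurent series: logarithmic derivatives, residues and Frobenius lifts *)

(* The logarithmic partial derivative [t_j d/dt_j]. *)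
Fixpoint theta (A : comPzRingType) (n j : nat) : {additive iterL A n -> iterL A n} :=
  if n is m.+1 return {additive iterL A n -> iterL A n} then
    if j == m then (@leuler (iterL A m) : {additive laurent _ -> laurent _})
    else (lmap (theta A m j) : {additive laurent _ -> laurent _})
  else \0.

Fixpoint tvar (A : comPzRingType) (n j : nat) : iterL A n :=
  if n is m.+1 return iterL A n then
    if j == m then lmono (1 : iterL A m) 1 else lmono (tvar A m j) 0
  else 1.

(** The residue of [f dt_1/t_1 /\ ... /\ dt_n/t_n]. *)
Definition const_coef (A : comPzRingType) (n : nat) (f : iterL A n) : A :=
  icoef f (fun=> 0).

Section IteratedLaurent.
Context (A : comPzRingType).

Lemma icoefB n (l : nat -> int) : zmod_morphism ((@icoef A n)^~ l).
Proof. by elim: n => [//|n IHn] f g; exact: IHn. Qed.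

Lemma const_coef_is_zmod_morphism n : zmod_morphism (@const_coef A n).
Proof. exact: icoefB. Qed.
HB.instance Definition _ n := GRing.isZmodMorphism.Build (iterL A n) A
  (@const_coef A n) (@const_coef_is_zmod_morphism n).

Lemma iterL_torsion_free n : torsion_free A -> torsion_free (iterL A n).
Proof. by move=> tf; elim: n => [//|n IHn]; exact: laurent_torsion_free. Qed.

Lemma theta_derivation n j : derivation (theta A n j).
Proof.
elim: n => [|n IHn] /=; first by move=> x y /=; rewrite mul0r mulr0 addr0.
by case: eqP => _; [exact: leuler_derivation|exact: lmap_derivation].
Qed.

Lemma thetaC n j k (x : iterL A n) : theta A n j (theta A n k x) = theta A n k (theta A n j x).
Proof.
elim: n x => [//|n IHn] x /=.
case: (j =P n) => [_|_]; case: (k =P n) => [_|_] //; apply: laurentP => i /=.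
- by rewrite raddfMz.
- by rewrite raddfMz.
- exact: IHn.
Qed.

Lemma const_coef_theta n j (x : iterL A n) : const_coef (theta A n j x) = 0.
Proof.
elim: n x => [//|n IHn] x /=; case: eqP => _; last exact: IHn.
by rewrite /const_coef /= mulr0z; exact: (raddf0 (@const_coef A n)).
Qed.

Lemma lmono0_prod (R : comPzRingType) (I : Type) (r : seq I) (P : pred I) (F : I -> R) :
  lmono (\prod_(i <- r | P i) F i) 0 = \prod_(i <- r | P i) lmono (F i) 0.
Proof.
apply: (big_morph (fun a => lmono a 0)); last exact: lmono1.
by move=> a b /=; rewrite lmonoM addr0.
Qed.

Lemma theta_pderiv n (j : 'I_n) (x : iterL A n) :
  theta A n j x = tvar A n j * pderiv A n j x.
Proof.
case: j => j /= jn; elim: n x jn => [//|n IHn] x jn /=.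
case: eqP => [_|/eqP jn']; apply: laurentP => i; rewrite lcoef_mono_mul.
  by rewrite mul1r /= subrK.
by rewrite subr0; apply: IHn; lia.
Qed.

Lemma const_coef_tvar n (x : iterL A n) :
  const_coef (\prod_(j < n) tvar A n j * x) = icoef x (fun=> -1).
Proof.
elim: n x => [|n IHn] x; first by rewrite big_ord0 mul1r.
rewrite big_ord_recr /= eqxx.
rewrite (eq_bigr (fun j : 'I_n => lmono (tvar A n j) 0)) => [|j _]; last first.
  by rewrite (_ : _ == n = false)//; have := ltn_ord j; lia.
rewrite -mulrA -lmono0_prod; set y : laurent (iterL A n) := _ * _.
have -> : const_coef (y : iterL A n.+1) = const_coef (y 0) by [].
by rewrite /y !lcoef_mono_mul mul1r subr0 sub0r; exact: IHn.
Qed.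

(** [Phi] sends each [t_j] to [t_j^p] and applies [phi] to the coefficients; exponents are
    multiplied by [p], whence the factor [p] in the rule for [theta]. *)
Lemma iter_frobenius (p : nat) (phi : {rmorphism A -> A}) : prime p ->
    frobenius_lift p phi -> forall n, exists Phi : {rmorphism iterL A n -> iterL A n},
  [/\ frobenius_lift p Phi,
    forall j x, theta A n j (Phi x) = Phi (theta A n j x) *+ p &
    forall x, const_coef (Phi x) = phi (const_coef x)].
Proof.
move=> p_prime phiP; elim=> [|n [Phi [PhiP thetaP rhoP]]].
  by exists phi; split=> // j x /=; rewrite rmorph0 mul0rn.
have p0 := prime_gt0 p_prime.
exists (lfrob_rmorphism Phi p0); split.
- exact: lfrob_lift.
- move=> j x; apply: laurentP => i /=.
  have [_|_] := eqVneq j n; rewrite lcoefMn /=; case: ifP => [/dvdzP[q ->]|_].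
  + by rewrite mulzK ?raddfMz/= ?mulrzA//; lia.
  + by rewrite mul0rz mul0rn.
  + exact: thetaP.
  + by rewrite raddf0 mul0rn.
- move=> x; rewrite /const_coef /= dvdz0 div0z; exact: rhoP.
Qed.

End IteratedLaurent.

Section IteratedLaurentMap.
Context (A A' : comPzRingType) (psi : {rmorphism A -> A'}).

Lemma icoef_map n (x : iterL A n) l : icoef (iterL_map psi n x) l = psi (icoef x l).
Proof. by elim: n x => [//|n IHn] x; exact: IHn. Qed.

Lemma const_coef_map n (x : iterL A n) :
  const_coef (iterL_map psi n x) = psi (const_coef x).
Proof. exact: icoef_map. Qed.

Lemma theta_map n j (x : iterL A n) :
  theta A' n j (iterL_map psi n x) = iterL_map psi n (theta A n j x).
Proof.
elim: n x => [|n IHn] x /=; first by rewrite rmorph0.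
by case: eqP => _; apply: laurentP => i /=; rewrite ?raddfMz.
Qed.

End IteratedLaurentMap.

Lemma iterL_map_comp (A A' A'' : comPzRingType) (psi : {rmorphism A -> A'})
    (psi' : {rmorphism A' -> A''}) (psi'' : {rmorphism A -> A''}) n :
    (forall x, psi'' x = psi' (psi x)) ->
  forall x, iterL_map psi'' n x = iterL_map psi' n (iterL_map psi n x).
Proof. by move=> h; elim: n => [//|n IHn] x; apply: laurentP => i /=. Qed.

(** The lift is chosen coefficient by coefficient; where both coefficients vanish it is taken to be
    0, so that the result stays bounded below. *)
Lemma iterL_lift2 (B B1 B2 A : comPzRingType)
    (q1 : {rmorphism B -> B1}) (q2 : {rmorphism B -> B2})
    (pi1 : {rmorphism B1 -> A}) (pi2 : {rmorphism B2 -> A}) n :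
    (forall b1 b2, pi1 b1 = pi2 b2 -> exists b, q1 b = b1 /\ q2 b = b2) ->
  forall x1 x2, iterL_map pi1 n x1 = iterL_map pi2 n x2 ->
    exists x, iterL_map q1 n x = x1 /\ iterL_map q2 n x = x2.
Proof.
move=> q12; elim: n => [//|n IHn] x1 x2 x12.
have ex i : exists b, [/\ iterL_map q1 n b = x1 i, iterL_map q2 n b = x2 i &
    x1 i = 0 -> x2 i = 0 -> b = 0].
  have [[x10 x20]|x0] := pselect (x1 i = 0 /\ x2 i = 0).
    by exists 0; rewrite !rmorph0 x10 x20.
  have [|b [b1 b2]] := IHn (x1 i) (x2 i).
    by have := congr1 (fun f : laurent _ => f i) x12.
  by exists b; split=> // x10 x20; case: x0.
pose b i := sval (cid (ex i)); have bP i := svalP (cid (ex i)).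
have b0 : exists N : nat, forall i : int, i < - N%:Z -> b i = 0.
  have [N1 x1N] := lcoef_bounded x1; have [N2 x2N] := lcoef_bounded x2.
  exists (N1 + N2)%N => i iN; have [_ _] := bP i.
  by apply; [apply: x1N|apply: x2N]; lia.
by exists (Laurent b0); split; apply: laurentP => i /=; have [] := bP i.
Qed.

Lemma iterL_lift (B A : comPzRingType) (q : {rmorphism B -> A}) n :
  (forall a, exists b, q b = a) -> forall x, exists y, iterL_map q n y = x.
Proof.
move=> q_surj x; pose i : {rmorphism A -> A} := idfun.
have qi (a b : A) : i a = i b -> exists c, q c = a /\ q c = b.
  by move=> /= <-; have [c <-] := q_surj a; exists c.
by have [y [yx _]] := iterL_lift2 qi (erefl (iterL_map i n x)); exists y.
Qed.

(** * Wedge products of one-forms *)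

Section WedgeDeterminant.
Context (R : comPzRingType) (n : nat).
Implicit Types (K : {set 'I_n}) (w : form R n) (a : 'I_n -> R).

Definition one_form a : form R n := \sum_(j < n) fscale (a j) (dt R j).

Lemma one_formE a K : one_form a K = \sum_(j < n) a j * (K == [set j])%:R.
Proof. by rewrite sum_ffunE; apply: eq_bigr => j _; rewrite !ffunE. Qed.


Lemma inversions1 (j : 'I_n) K :
  inversions [set j] K = #|[set x in K | (x < j)%N]|.
Proof.
have pair_inj : injective (pair j : 'I_n -> 'I_n * 'I_n) by move=> x y [].
rewrite /inversions -(card_imset _ pair_inj); apply: eq_card => -[i x].
rewrite !inE /=; apply/and3P/imsetP => [[/eqP-> xK xj]|[y]].
  by exists x; rewrite ?inE ?xK.
by rewrite !inE => /andP[yK yj] [-> ->].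
Qed.

Lemma wedge_one_form a w K : wedge (one_form a) w K =
  \sum_(j in K) (-1) ^+ #|[set x in K | (x < j)%N]| * (a j * w (K :\ j)).
Proof.
rewrite ffunE.
under eq_bigr => I _ do rewrite one_formE mulr_suml mulr_sumr.
rewrite exchange_big/= [RHS]big_mkcond/=; apply: eq_bigr => j _.
rewrite -finset.sub1set; case: ifP => jK; last first.
  rewrite big1// => I IK; case: eqP => [IE|_]; last by rewrite mulr0 mul0r mulr0.
  by rewrite -IE IK in jK.
rewrite (bigD1 [set j])//= eqxx mulr1 big1 ?addr0 => [|I /andP[_ /negbTE->]].
  rewrite inversions1; congr ((-1) ^+ _ * _); apply: eq_card => x.
  by rewrite !inE; case: eqP => [->|]; rewrite ?ltnn ?andbF.
by rewrite mulr0 mul0r mulr0.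
Qed.

(** Laplace expansion along the first row. The increasing map [c] selects the columns of a minor:
    deleting column [j] replaces [c] by its composite with [lift j]. *)
Lemma wedge_one_forms m (a : 'I_m -> 'I_n -> R) (c : 'I_m -> 'I_n) :
    (forall i j : 'I_m, (i < j)%N -> (c i < c j)%N) ->
  (\big[@wedge R n/fone R n]_(k < m) one_form (a k)) [set c i | i in 'I_m] =
  \det (\matrix_(i, j) a i (c j)).
Proof.
elim: m a c => [|m IHm] a c c_incr.
  rewrite big_ord0 det_mx00 ffunE (_ : _ == _)//.
  by apply/eqP/setP => x; rewrite inE; apply/imsetP => -[[]].
have c_inj : injective c.
  move=> i j cij; apply/val_inj; case: (ltngtP i j) => // /c_incr; rewrite cij ltnn//.
have c_lt i j : (c i < c j)%N = (i < j)%N.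
  case: (ltngtP i j) => [/c_incr//|/c_incr|/val_inj->]; last by rewrite ltnn.
  by move=> cji; apply/negbTE; rewrite -leqNgt ltnW.
rewrite big_ord_recl wedge_one_form big_imset/=; last by move=> i j _ _ /c_inj.
rewrite (expand_det_row _ ord0); apply: eq_bigr => j _; rewrite !mxE /cofactor.
(* The sign in the wedge counts the selected columns before [c j]; there are [j] of them because [c]
   is increasing. *)
have -> : #|[set x in [set c i | i in 'I_m.+1] | (x < c j)%N]| = j.
  pose f (x : 'I_j) := c (widen_ord (ltnW (ltn_ord j)) x).
  have f_inj : injective f by move=> x y /c_inj/(congr1 val)/= /val_inj.
  rewrite -[RHS](card_ord j) -(card_imset _ f_inj); apply: eq_card => x; rewrite inE.
  apply/andP/imsetP => [[/imsetP[i _ ->]]|[i _ ->]]; last by rewrite /f imset_f// c_lt /=.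
  by rewrite c_lt => ij; exists (Ordinal ij) => //; congr c; exact: val_inj.
have -> : [set c i | i in 'I_m.+1] :\ c j = [set c (lift j i) | i in 'I_m].
  apply/setP => x; rewrite !inE; apply/andP/imsetP => [[xj /imsetP[i _ xE]]|[i _ ->]].
    rewrite xE (inj_eq c_inj) in xj; have [i' iE|iE] := unliftP j i.
      by exists i'; rewrite // xE iE.
    by rewrite iE eqxx in xj.
  by rewrite (inj_eq c_inj) eq_sym neq_lift imset_f.
rewrite IHm => [|i i' ii']; last by rewrite c_incr//= /bump; lia.
rewrite add0n mulrCA; congr (_ * (_ * \det _)).
by apply/matrixP => k l; rewrite !mxE.
Qed.

End WedgeDeterminant.

(** * Polynomial rings over the integers *)

Lemma ndvd_fermat (R : comPzRingType) (p : nat) (c : int) :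
  prime p -> ndvd p (c%:~R - c%:~R ^+ p : R).
Proof.
move=> p_prime; have p0 := prime_gt0 p_prime.
have natP n : ndvd p (n%:R - n%:R ^+ p : R).
  elim: n => [|n IHn]; first by rewrite expr0n gtn_eqF// subr0; exact: ndvd0.
  rewrite -natr1; apply: ndvd_trans (ndvd_sym (ndvd_exprD _ _ p_prime)).
  rewrite expr1n opprD addrACA subrr addr0; exact: IHn.
case: c => n; first exact: natP.
rewrite NegzE mulrNz -pmulrn; set x : R := n.+1%:R.
apply: (@ndvd_trans _ _ _ (- x ^+ p)).
  by rewrite -opprD; apply: ndvdN; exact: natP.
(* Expanding [(x - x)^p = 0] modulo [p] compares [(-x)^p] with [- x^p] without distinguishing the
   parity of [p]. *)
rewrite -opprD; apply: ndvdN; have := ndvd_exprD x (- x) p_prime.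
by rewrite subrr expr0n gtn_eqF// sub0r => /ndvdN; rewrite opprK.
Qed.

Lemma frobenius_lift_span (R : comPzRingType) (K : Type) (monom : K -> R) (p : nat)
    (phi : {rmorphism R -> R}) : prime p ->
    (forall g, exists (s : seq K) (c : K -> int), g = \sum_(k <- s) (c k)%:~R * monom k) ->
    (forall k, phi (monom k) = monom k ^+ p) ->
  frobenius_lift p phi.
Proof.
move=> p_prime span phi_monom g; have [s [c ->]] := span g; have p0 := prime_gt0 p_prime.
pose good x := ndvd p (phi x - x ^+ p); rewrite -/(good _).
elim/big_ind: _ => [|x y|k _]; last first.
- rewrite /good rmorphM rmorph_int exprMn phi_monom -mulrBl; apply: ndvd_mulr.
  exact: ndvd_fermat.
- exact: (ndvd_frobD (phi := phi)).
- by rewrite /good rmorph0 expr0n gtn_eqF// subr0; exact: ndvd0.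
Qed.

Section FreeRing.
Context (X : choiceType).

(** The polynomial ring over Z in an arbitrary, possibly infinite, set of variables; every ring is a
    quotient of such a ring. *)
Definition free_ring : comPzRingType := {malg int[{cmonom X}]}.
Definition free_gen (x : X) : free_ring := mkmalgU (ucm x) 1.

Lemma free_ring_torsion_free : torsion_free free_ring.
Proof.
move=> g m m0 gm; apply/malgP => k; rewrite mcoeff0.
have /(congr1 (mcoeff k)) := gm; rewrite mcoeffMn mcoeff0 => /eqP.
by rewrite mulrn_eq0 gtn_eqF//= => /eqP.
Qed.

Let monom (k : {cmonom X}) : free_ring := mkmalgU k 1.

Let monomM k l : monom (mmul k l) = monom k * monom l.
Proof. by rewrite /monom [RHS]malgM_def fgmulUU mulr1. Qed.

Let free_ringE (g : free_ring) : g = \sum_(k <- msupp g) (g@_k)%:~R * monom k.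
Proof.
rewrite {1}[g]monalgE; apply: eq_bigr => k _; rewrite /monom.
by rewrite mulrzl -[RHS]raddfMz/= -[g@_k in LHS]intz.
Qed.

Lemma free_ring_ext (A : comPzRingType) (psi psi' : {rmorphism free_ring -> A}) :
  (forall x, psi (free_gen x) = psi' (free_gen x)) -> psi =1 psi'.
Proof.
move=> psi_gen; suff psi_monom k : psi (monom k) = psi' (monom k).
  move=> g; rewrite [g]free_ringE !rmorph_sum; apply: eq_bigr => k _.
  by rewrite !rmorphM !rmorph_int psi_monom.
have [d] := ubnP (mdeg k); elim: d k => // d IHd k kd.
have [->|k1] := eqVneq k mone; first by rewrite !rmorph1.
have [i ik] : exists i, i \in finsupp k.
  have [k0|[i ik]] := fset_0Vmem (finsupp k); last by exists i.
  case/eqP: k1; apply/eqP/cmP => i; rewrite cm1; apply/eqP.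
  by rewrite cmE_eq0 k0 in_fset0.
have kE : k = mmul (ucm i) (divcm k (ucm i)).
  apply/eqP/cmP => j; rewrite cmM divcmE cmU.
  case: (i =P j) => [<-|_]; last by rewrite subn0.
  by rewrite subnKC// lt0n cmE_neq0.
have mE : monom k = free_gen i * monom (divcm k (ucm i)) by rewrite -monomM -kE.
have ld : (mdeg (divcm k (ucm i)) < d)%N by move: kd; rewrite {1}kE mdegM mdegU.
rewrite mE; apply: etrans (rmorphM psi _ _) (etrans _ (esym (rmorphM psi' _ _))).
by apply: f_equal2; [exact: psi_gen|exact: IHd].
Qed.

Section Eval.
Context (A : comNzRingType) (h : X -> A).

Let eval_monom (k : {cmonom X}) : A := \prod_(i <- finsupp k) h i ^+ k i.

Let eval_monomEw (d : {fset X}) (k : {cmonom X}) : (finsupp k `<=` d)%fset ->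
  eval_monom k = \prod_(i <- d) h i ^+ k i.
Proof.
move=> kd; apply: big_fset_incl => // i _; rewrite -cmE_eq0 => /eqP->.
by rewrite expr0.
Qed.

Let eval_monom_mmorphism : mmorphism eval_monom.
Proof.
split=> [k l|]; last by rewrite /eval_monom mdom1 big_seq_fset0.
pose d := (finsupp k `|` finsupp l)%fset.
rewrite (@eval_monomEw d k) ?fsubsetUl// (@eval_monomEw d l) ?fsubsetUr//.
rewrite (@eval_monomEw d) ?mdomD// -big_split/=; apply: eq_bigr => i _.
by rewrite cmM exprD.
Qed.

Lemma free_eval_nz : exists psi : {rmorphism free_ring -> A},
  (forall x, psi (free_gen x) = h x) /\
  forall k, psi (mkmalgU k 1) = \prod_(i <- finsupp k) h i ^+ k i.
Proof.
pose e := monalg.isMultiplicative.Build _ _ eval_monom eval_monom_mmorphism.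
pose e' : monalg.MMorphism.type {cmonom X} A := HB.pack eval_monom e.
pose psi : {rmorphism {malg int[{cmonom X}]} -> A} := mmap (intr : int -> A) e'.
exists psi; split=> [x|k]; rewrite /psi/= mmapU mul1r /= /eval_monom//.
by rewrite mdomU big_seq_fset1 cmUU expr1.
Qed.

End Eval.

Lemma free_eval (A : comPzRingType) (h : X -> A) :
  exists psi : {rmorphism free_ring -> A}, forall x, psi (free_gen x) = h x.
Proof.
have [A0|A1] := eqVneq (1 : A) 0.
  have a0 (a b : A) : a = b by rewrite -[a]mul1r -[b]mul1r A0 !mul0r.
  pose f (_ : free_ring) : A := 0.
  have fB : zmod_morphism f by move=> x y; exact: a0.
  have fM : monoid_morphism f by split=> [|x y]; exact: a0.
  pose fz := GRing.isZmodMorphism.Build _ _ f fB.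
  pose fm := GRing.isMonoidMorphism.Build _ _ f fM.
  pose psi : {rmorphism free_ring -> A} := HB.pack f fz fm.
  by exists psi => i; exact: a0.
pose nzA := GRing.PzSemiRing_isNonZero.Build A A1.
pose A' : comNzRingType := HB.pack (GRing.ComPzRing.sort A) nzA.
by have [psi [psiE _]] := @free_eval_nz A' h; exists psi.
Qed.

Lemma free_frobenius (p : nat) : prime p ->
  exists phi : {rmorphism free_ring -> free_ring}, frobenius_lift p phi.
Proof.
move=> p_prime; have p0 := prime_gt0 p_prime.
have [phi [phi_gen phi_monom]] :=
  @free_eval_nz {malg int[{cmonom X}]} (fun x => free_gen x ^+ p).
(* [psi] is the identity by [free_ring_ext]; its formula writes a monomial as a product of
   variables, each of which [phi] raises to the power [p]. *)
have [psi [psi_gen psi_monom]] := @free_eval_nz {malg int[{cmonom X}]} free_gen.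
have monomE k : psi (monom k) = monom k.
  by rewrite (@free_ring_ext _ psi idfun).
exists phi; apply: (@frobenius_lift_span _ _ monom p phi p_prime) => [g|k].
  by exists (msupp g), (fun k => g@_k); exact: free_ringE.
rewrite -[in RHS]monomE [RHS]/= psi_monom phi_monom -prodrXl.
by apply: eq_bigr => i _; rewrite exprAC.
Qed.

End FreeRing.

(** * The pairing for arbitrary series *)

Section WittTheory.
Context (S : truncset).

Lemma witt_map_is_zmod_morphism (A B : comPzRingType) (phi : {rmorphism A -> B}) :
  zmod_morphism (@witt_map S A B phi).
Proof.
move=> w v; apply/eqP; rewrite eq_sym subr_eq -witt_mapD subrK; exact: eqxx.
Qed.
HB.instance Definition _ (A B : comPzRingType) (phi : {rmorphism A -> B}) :=
  GRing.isZmodMorphism.Build (witt S A) (witt S B) (@witt_map S A B phi)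
    (witt_map_is_zmod_morphism phi).

Lemma wghost_map (A B : comPzRingType) (phi : {rmorphism A -> B}) (w : witt S A) i :
  wghost (witt_map phi w) i = phi (wghost w i).
Proof.
by rewrite /wghost ghost_rmorph; congr ghost; apply: funext => d; exact: wcoord_map.
Qed.

Lemma wghost_inj (A : comPzRingType) (w v : witt S A) : torsion_free A ->
  (forall i, S i -> wghost w i = wghost v i) -> w = v.
Proof.
move=> tf wv; apply: funext => -[i Si]; have i0 := tset_gt0 Si.
rewrite -(wcoordE w) -(wcoordE v) /=.
by apply: (ghost_inj tf i0) (dvdnn i) => d di; apply: wv; exact: tset_dvd di.
Qed.

Lemma wghost_of_seq (A : comPzRingType) (c : nat -> A) i : S i ->
  wghost (fun j : {j | S j} => c (sval j)) i = ghost c i.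
Proof.
move=> Si; apply: eq_ghost (tset_gt0 Si) _ => d di.
by rewrite (wcoordE _ (exist _ d (tset_dvd Si di))).
Qed.

End WittTheory.

(** Multiplication by the Teichmüller representative of [v]. *)
Lemma ghost_rescale (A : comPzRingType) (w : nat -> A) v i : (0 < i)%N ->
  ghost (fun d => v ^+ d * w d) i = v ^+ i * ghost w i.
Proof.
move=> i0; rewrite mulr_sumr; apply: eq_big_seq => d; rewrite -dvdn_divisors// => di.
by rewrite exprMn -exprM mulnC divnK// mulrnAr.
Qed.

(* The ghost coordinates of the pairing, without inverses: for units f_k and
   [v = \prod_k (f_k)^-1], [y = f], they are the residues of the theorem, but they are
   defined for arbitrary series v and y_k, which can be lifted to any ring mapping
   onto A. *)
Section PairingGhost.
Context (n : nat) (S : truncset).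

Definition pairing_ghost (A : comPzRingType) (g : witt S (iterL A n)) (v : iterL A n)
    (y : 'I_n -> iterL A n) (i : nat) : A :=
  const_coef (ghost_form (fun j : 'I_n => theta A n j) (fun d => v ^+ d * wcoord g d) y i).

Lemma pairing_ghostE (A : comPzRingType) (g : witt S (iterL A n)) v y i : S i ->
  pairing_ghost g v y i = const_coef (wghost g i * v ^+ i * \prod_k y k ^+ i.-1 *
    \det (jacobian (fun j : 'I_n => theta A n j) y)).
Proof.
move=> Si; rewrite /pairing_ghost /ghost_form ghost_rescale ?(tset_gt0 Si)//.
by rewrite [v ^+ i * _]mulrC.
Qed.

Lemma pairing_ghost_map (A B : comPzRingType) (psi : {rmorphism A -> B})
    (g : witt S (iterL A n)) v y i : S i ->
  pairing_ghost (witt_map (iterL_map psi n) g) (iterL_map psi n v)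
    (fun k => iterL_map psi n (y k)) i = psi (pairing_ghost g v y i).
Proof.
move=> Si; rewrite !pairing_ghostE// -const_coef_map wghost_map; congr const_coef.
rewrite !rmorphM rmorphXn rmorph_prod -det_map_mx.
congr (_ * _); first by congr (_ * _); apply: eq_bigr => k _; rewrite rmorphXn.
by congr (\det _); apply/matrixP => k j; rewrite !mxE theta_map.
Qed.

(** Dwork's criterion over a polynomial ring; its congruences are those of [ghost_form_frob], with
    [const_coef] as [rho]. *)
Lemma pairing_ghost_integral (X : choiceType) (g : witt S (iterL (free_ring X) n)) v y :
  exists c : witt S (free_ring X), forall i, S i -> wghost c i = pairing_ghost g v y i.
Proof.
set B := free_ring X in g v y *.
have tf : torsion_free B := @free_ring_torsion_free X.
have ex p : exists phi : {rmorphism B -> B}, prime p -> frobenius_lift p phi.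
  have [p_prime|_] := boolP (prime p); last by exists idfun.
  by have [phi phiP] := @free_frobenius X p p_prime; exists phi.
pose phi p := sval (cid (ex p)).
have phiP p : prime p -> frobenius_lift p (phi p) := svalP (cid (ex p)).
have [|c cP] := dwork tf phiP (r := pairing_ghost g v y).
  move=> p i p_prime i0 pi.
  have [Phi [PhiP thetaP rhoP]] := iter_frobenius p_prime (phiP p p_prime) n.
  apply: (ghost_form_frob (iterL_torsion_free tf) tf _ _ _ p_prime PhiP) => //.
  - by move=> j; exact: theta_derivation.
  - by move=> j k x; exact: thetaC.
  - by move=> j x; exact: const_coef_theta.
by exists (fun i => c (sval i)) => i Si; rewrite wghost_of_seq// cP// (tset_gt0 Si).
Qed.

End PairingGhost.

(** * Independence of the lift, functoriality and identities of the pairing *)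

Section Pairing.
Context (n : nat) (S : truncset).

(** The graph of the pairing: some lift of the data to a polynomial ring, with a Witt vector there
    having the prescribed ghost coordinates, maps to the given data and value. *)
Inductive pairing_rel (A : comPzRingType) :
    witt S (iterL A n) -> iterL A n -> ('I_n -> iterL A n) -> witt S A -> Prop :=
  PairingRel (X : choiceType) (pi : {rmorphism free_ring X -> A}) g v y c of
    (forall i, S i -> wghost c i = pairing_ghost g v y i) :
  pairing_rel (witt_map (iterL_map pi n) g) (iterL_map pi n v)
    (fun k => iterL_map pi n (y k)) (witt_map pi c).

Lemma lift_witt (A B : comPzRingType) (q : {rmorphism B -> A}) (w : witt S A) :
  (forall a, exists b, q b = a) -> exists w', witt_map q w' = w.
Proof.
move=> q_surj; exists (fun i => sval (cid (q_surj (w i)))).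
by apply: funext => i; exact: svalP (cid (q_surj (w i))).
Qed.

Lemma free_cover (A : comPzRingType) :
  exists pi : {rmorphism free_ring A -> A}, forall a, exists b, pi b = a.
Proof. by have [pi piE] := free_eval (id : A -> A); exists pi => a; exists (free_gen a). Qed.

Lemma pairing_rel_ex (A : comPzRingType) g v y : exists c, @pairing_rel A g v y c.
Proof.
have [pi pi_surj] := free_cover A; have piL := iterL_lift pi_surj (n := n).
have [g' <-] := lift_witt g piL; have [v' <-] := piL v.
have [y' yE] := fin_all_exists (fun k => piL (y k)).
have -> : y = fun k => iterL_map pi n (y' k) by apply: funext => k.
have [c cP] := pairing_ghost_integral g' v' y'.
by exists (witt_map pi c); constructor.
Qed.

(** Two lifts agreeing in [A] come from the free ring on the fibre product [D]. The Witt vector of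
    the common lift maps to both given ones, as ghost coordinates are injective over free rings, and
    the two composites to [A] coincide. *)
Lemma pairing_rel_uniq (A : comPzRingType) g v y c1 c2 :
  @pairing_rel A g v y c1 -> pairing_rel g v y c2 -> c1 = c2.
Proof.
move=> [X1 pi1 g1 v1 y1 {}c1 c1P].
(* The images in [A] are named first, so that inverting the second relation leaves equations between
   the images of the two lifts. *)
move gE: (witt_map _ g1) => g0; move vE: (iterL_map _ _ v1) => v0.
move yE: (fun k => iterL_map pi1 n (y1 k)) => y0 r2.
case: r2 gE vE yE => X2 pi2 g2 v2 y2 {}c2 c2P gE vE yE.
pose D : choiceType := {b : free_ring X1 * free_ring X2 | pi1 b.1 == pi2 b.2}.
have [q1 q1E] := free_eval (fun b : D => (val b).1).
have [q2 q2E] := free_eval (fun b : D => (val b).2).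
have q12 : pi1 \o q1 =1 pi2 \o q2.
  apply: (free_ring_ext (psi := pi1 \o q1) (psi' := pi2 \o q2)) => b /=.
  rewrite q1E q2E; exact/eqP/(valP b).
have q_surj b1 b2 : pi1 b1 = pi2 b2 -> exists b, q1 b = b1 /\ q2 b = b2.
  move=> /eqP b12; exists (free_gen (exist _ (b1, b2) b12 : D)).
  by rewrite q1E q2E.
have qL := iterL_lift2 q_surj.
have [v' [v1E v2E]] := qL n v1 v2 vE.
have /fin_all_exists[y' yP] k : exists x, iterL_map q1 n x = y1 k /\ iterL_map q2 n x = y2 k.
  by apply: qL; exact: (congr1 (fun y => y k) yE).
have gP i : exists x, iterL_map q1 n x = g1 i /\ iterL_map q2 n x = g2 i.
  by apply: qL; exact: (congr1 (fun g => g i) gE).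
pose g' i := sval (cid (gP i)).
have [c cP] := pairing_ghost_integral g' v' y'.
have c1E : witt_map q1 c = c1.
  apply: (wghost_inj (@free_ring_torsion_free X1)) => i Si; rewrite wghost_map cP// c1P//.
  rewrite -pairing_ghost_map// v1E; congr (pairing_ghost _ _ _ _).
    by apply: funext => j; have [] := svalP (cid (gP j)).
  by apply: funext => k; have [] := yP k.
have c2E : witt_map q2 c = c2.
  apply: (wghost_inj (@free_ring_torsion_free X2)) => i Si; rewrite wghost_map cP// c2P//.
  rewrite -pairing_ghost_map// v2E; congr (pairing_ghost _ _ _ _).
    by apply: funext => j; have [] := svalP (cid (gP j)).
  by apply: funext => k; have [] := yP k.
by rewrite -c1E -c2E; apply: funext => i; exact: q12.
Qed.

Definition pairing (A : comPzRingType) (g : witt S (iterL A n)) v y : witt S A :=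
  sval (cid (pairing_rel_ex g v y)).

Lemma pairingP (A : comPzRingType) (g : witt S (iterL A n)) v y :
  pairing_rel g v y (pairing g v y).
Proof. exact: svalP (cid (pairing_rel_ex g v y)). Qed.

(** A lift along [pi] of data over [A] is a lift along [psi \o pi] of their images over [B];
    uniqueness concludes. *)
Lemma pairing_map (A B : comPzRingType) (psi : {rmorphism A -> B})
    (g : witt S (iterL A n)) v y :
  pairing (witt_map (iterL_map psi n) g) (iterL_map psi n v)
    (fun k => iterL_map psi n (y k)) = witt_map psi (pairing g v y).
Proof.
apply: pairing_rel_uniq (pairingP _ _ _) _.
case: (pairing g v y) / (pairingP g v y) => X pi g' v' y' c cP.
have LE x : iterL_map (psi \o pi) n x = iterL_map psi n (iterL_map pi n x).
  exact: iterL_map_comp.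
have := @PairingRel B X (psi \o pi) g' v' y' c cP.
rewrite LE (_ : witt_map (iterL_map _ n) g' = witt_map (iterL_map psi n) (witt_map (iterL_map pi n) g')).
  rewrite (_ : (fun k => _) = fun k => iterL_map psi n (iterL_map pi n (y' k)))//.
  by apply: funext => k; exact: LE.
by apply: funext => j; exact: LE.
Qed.

Lemma wghost_pairing (A : comPzRingType) (g : witt S (iterL A n)) v y i : S i ->
  wghost (pairing g v y) i = pairing_ghost g v y i.
Proof.
move=> Si; case: (pairing g v y) / (pairingP g v y) => X pi g' v' y' c cP.
by rewrite wghost_map cP// pairing_ghost_map.
Qed.

(** By functoriality the identity may be checked on lifts to a polynomial ring, where ghost
    coordinates determine a Witt vector. The identities below are proved likewise. *)
Lemma pairingDl (A : comPzRingType) (g h : witt S (iterL A n)) v y :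
  pairing (g + h) v y = pairing g v y + pairing h v y.
Proof.
have [pi pi_surj] := free_cover A; have piL := iterL_lift pi_surj (n := n).
have [g' <-] := lift_witt g piL; have [h' <-] := lift_witt h piL; have [v' <-] := piL v.
have [y' yE] := fin_all_exists (fun k => piL (y k)).
have -> : y = fun k => iterL_map pi n (y' k) by apply: funext => k.
rewrite -witt_mapD !pairing_map -witt_mapD; congr witt_map.
apply: (wghost_inj (@free_ring_torsion_free A)) => i Si.
rewrite wghostD// !wghost_pairing// !pairing_ghostE// wghostD//.
by rewrite !mulrDl raddfD.
Qed.

Lemma jacobian_replaceM (R : comPzRingType) (D : 'I_n -> {additive R -> R}) y (k : 'I_n) a b :
    (forall j, derivation (D j)) ->
  \det (jacobian D (replace y k (a * b))) =
  a * \det (jacobian D (replace y k b)) + b * \det (jacobian D (replace y k a)).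
Proof.
move=> DM; apply: (determinant_multilinear (i0 := k)).
- apply/rowP => j; rewrite !mxE /replace eqxx DM addrC; congr (_ + _).
  by rewrite mulrC.
- by apply/matrixP => l j; rewrite !mxE /replace ![lift k l == k]eq_sym (negbTE (neq_lift k l)).
- by apply/matrixP => l j; rewrite !mxE /replace ![lift k l == k]eq_sym (negbTE (neq_lift k l)).
Qed.

Lemma iterL_map_replace (A B : comPzRingType) (psi : {rmorphism A -> B}) y (k : 'I_n) a :
  (fun l => iterL_map psi n (replace y k a l)) =
  replace (fun l => iterL_map psi n (y l)) k (iterL_map psi n a).
Proof. by apply: funext => l; rewrite /replace; case: eqP. Qed.

(* The Leibniz rule [d[ab] = [a] d[b] + [b] d[a]]. *)
Lemma pairing_leibniz (A : comPzRingType) (g : witt S (iterL A n)) v y (k : 'I_n) a b :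
  pairing g v (replace y k (a * b)) =
  pairing g (v * a) (replace y k b) + pairing g (v * b) (replace y k a).
Proof.
have [pi pi_surj] := free_cover A; have piL := iterL_lift pi_surj (n := n).
have [g' <-] := lift_witt g piL; have [v' <-] := piL v.
have [a' <-] := piL a; have [b' <-] := piL b.
have [y' yE] := fin_all_exists (fun k => piL (y k)).
have -> : y = fun k => iterL_map pi n (y' k) by apply: funext => l.
rewrite -!rmorphM -!iterL_map_replace !pairing_map -witt_mapD; congr witt_map.
apply: (wghost_inj (@free_ring_torsion_free A)) => i Si; have i0 := tset_gt0 Si.
rewrite wghostD// !wghost_pairing// !pairing_ghostE// -raddfD; congr const_coef.
rewrite jacobian_replaceM; last by move=> j; exact: theta_derivation.
have prodE x : \prod_l replace y' k x l ^+ i.-1 = x ^+ i.-1 * \prod_(l | l != k) y' l ^+ i.-1.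
  rewrite (bigD1 k)//= {1}/replace eqxx; congr (_ * _).
  by apply: eq_bigr => l lk; rewrite /replace (negbTE lk).
(* This is [v^i (ab)^(i-1) (a db + b da) = (va)^i b^(i-1) db + (vb)^i a^(i-1) da]. *)
rewrite !prodE !exprMn -(prednK i0) !exprS /=; ring.
Qed.

(** Since [dy_l = - dy_k], two rows of the Jacobian are proportional. *)
Lemma pairing_steinberg (A : comPzRingType) (g : witt S (iterL A n)) v y (k l : 'I_n) :
  k != l -> y l = 1 - y k -> pairing g v y = 0.
Proof.
move=> kl ylk; have [pi pi_surj] := free_cover A; have piL := iterL_lift pi_surj (n := n).
have [g' <-] := lift_witt g piL; have [v' <-] := piL v.
have [y' yE] := fin_all_exists (fun k => piL (y k)).
(* Arbitrary lifts need not satisfy the relation, so entry [l] of the lift is replaced by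
   [1 - y' k]. *)
have -> : y = fun j => iterL_map pi n (replace y' l (1 - y' k) j).
  rewrite iterL_map_replace; apply: funext => j; rewrite /replace.
  by case: eqP => [->|_]; rewrite ?yE// rmorphB rmorph1 yE.
rewrite pairing_map -[RHS](raddf0 (@witt_map S _ _ pi)); congr witt_map.
apply: (wghost_inj (@free_ring_torsion_free A)) => i Si; have i0 := tset_gt0 Si.
rewrite wghost_pairing// pairing_ghostE//.
have -> : wghost (0 : witt S (free_ring A)) i = 0.
  by apply: (addrI (wghost (0 : witt S (free_ring A)) i)); rewrite -wghostD// !addr0.
set J := jacobian _ _; suff -> : \det J = 0 by rewrite mulr0 raddf0.
pose M := \matrix_(r, j) (if r == l then J k j else J r j).
have M0 : \det M = 0.
  by apply: (determinant_alternate kl) => j; rewrite !mxE eqxx (negbTE kl).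
have -> : \det J = -1 * \det M + 0 * \det M; last by rewrite M0 !mulr0 addr0.
apply: (determinant_multilinear (i0 := l)).
- apply/rowP => j; rewrite !mxE mul0r addr0 eqxx mulN1r /replace eqxx (negbTE kl).
  by rewrite raddfB (derivation1 (@theta_derivation _ n j)) sub0r.
- by apply/matrixP => r j; rewrite !mxE ![lift l r == l]eq_sym (negbTE (neq_lift l r)).
- by apply/matrixP => r j; rewrite !mxE ![lift l r == l]eq_sym (negbTE (neq_lift l r)).
Qed.

End Pairing.

(** * Extension to Milnor K-groups *)

(* Not the notation of monalg. *)
Local Notation "<< x >>" := (Freeg [:: (1, x)]) : ring_scope.

Section FreegAdditive.
Context (K : choiceType) (W : zmodType).

Definition freeg_lift (f : K -> W) (z : {freeg K}) : W :=
  fglift (f : K -> zmodule W) z.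

Fact freeg_lift_is_zmod_morphism f : zmod_morphism (freeg_lift f).
Proof. exact (@lift_is_additive int K (zmodule W) f). Qed.
HB.instance Definition _ f := GRing.isZmodMorphism.Build {freeg K} W
  (freeg_lift f) (freeg_lift_is_zmod_morphism f).

Lemma freeg_liftU f x : freeg_lift f << x >> = f x.
Proof. by rewrite /freeg_lift liftU scale1r. Qed.

Lemma freeg_ext (h h' : {additive {freeg K} -> W}) :
  (forall x, h << x >> = h' << x >>) -> h =1 h'.
Proof.
move=> hh' z; rewrite -[z]freeg_sumE !raddf_sum; apply: eq_bigr => x _.
by rewrite -[coeff x z]intz -freegU_mulz !raddfMz hh'.
Qed.

End FreegAdditive.

Section KMPairing.
Context (n : nat) (S : truncset) (A : comPzRingType).
Implicit Types (g h : witt S (iterL A n)) (f : {ffun 'I_n -> units (iterL A n)}).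

Definition symbol_pairing g f : witt S A :=
  pairing g (\prod_k uinv (f k)) (fun k => uval (f k)).

Definition freeg_pairing g := freeg_lift (symbol_pairing g).

(** In the Leibniz rule, the factor [uval u] or [uval v] cancels its inverse in the product of
    inverses, which leaves the symbol with the other unit in place [k]. *)
Lemma freeg_pairing_rel g x : multilinear_rel x -> freeg_pairing g x = 0.
Proof.
move=> [f [k [u [v ->]]]]; rewrite /freeg_pairing !raddfB/= !freeg_liftU.
pose V := \prod_(l | l != k) uinv (f l).
have prodE w : \prod_l uinv (upd f k w l) = uinv w * V.
  rewrite (bigD1 k)//= ffunE eqxx; congr (_ * _); apply: eq_bigr => l lk.
  by rewrite ffunE (negbTE lk).
have valE w : (fun l => uval (upd f k w l)) = replace (fun l => uval (f l)) k (uval w).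
  by apply: funext => l; rewrite ffunE /replace; case: eqP.
rewrite /symbol_pairing !prodE !valE [uval (umul u v)]/uval /= -!/(uval _) pairing_leibniz.
have -> : uinv (umul u v) * V * uval u = (uval u * uinv u) * (uinv v * V).
  by rewrite [uinv (umul u v)]/uinv /= -!/(uinv _); ring.
have -> : uinv (umul u v) * V * uval v = (uval v * uinv v) * (uinv u * V).
  by rewrite [uinv (umul u v)]/uinv /= -!/(uinv _); ring.
by rewrite !uvalV !mul1r addrK subrr.
Qed.

Definition tpow_pairing g (x : tpow n (iterL A n)) : witt S A := freeg_pairing g (qrepr x).

Lemma tpow_pairing_pi g z : tpow_pairing g (qpi _ z) = freeg_pairing g z.
Proof. exact: (qrepr_qpi (@freeg_pairing_rel g)). Qed.

Fact tpow_pairing_is_zmod_morphism g : zmod_morphism (tpow_pairing g).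
Proof.
move=> x y; rewrite -(qreprK x) -(qreprK y) -raddfB !tpow_pairing_pi.
exact: raddfB.
Qed.
HB.instance Definition _ g := GRing.isZmodMorphism.Build _ _
  (tpow_pairing g) (tpow_pairing_is_zmod_morphism g).

Lemma tpow_pairing_rel g x : steinberg_rel x -> tpow_pairing g x = 0.
Proof.
move=> [f [i [j [ij fij ->]]]]; rewrite tpow_pairing_pi /freeg_pairing freeg_liftU.
apply: (@pairing_steinberg _ _ _ _ _ _ i j) => //.
by apply/eqP => ij'; move: ij; rewrite ij'; lia.
Qed.

Definition KM_pairing (x : KM n (iterL A n)) g : witt S A := tpow_pairing g (qrepr x).

Lemma KM_pairing_pi t g : KM_pairing (qpi _ t) g = tpow_pairing g t.
Proof. exact: (qrepr_qpi (@tpow_pairing_rel g)). Qed.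

Lemma KM_repr (x : KM n (iterL A n)) : exists z, x = qpi _ (qpi _ z).
Proof. by exists (qrepr (qrepr x)); rewrite !qreprK. Qed.

Lemma KM_pairing_piE z g : KM_pairing (qpi _ (qpi _ z)) g = freeg_pairing g z.
Proof. by rewrite KM_pairing_pi tpow_pairing_pi. Qed.

Lemma KM_pairingDl x y g : KM_pairing (x + y) g = KM_pairing x g + KM_pairing y g.
Proof.
have [z ->] := KM_repr x; have [t ->] := KM_repr y.
pose q1 := qpi (@multilinear_rel n (iterL A n)).
pose q2 := qpi (@steinberg_rel n (iterL A n)).
have -> : q2 (q1 z) + q2 (q1 t) = q2 (q1 (z + t)) by rewrite /q2 /q1 !raddfD.
by rewrite !KM_pairing_piE /freeg_pairing raddfD.
Qed.

Lemma KM_pairingDr x g h : KM_pairing x (g + h) = KM_pairing x g + KM_pairing x h.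
Proof.
have [z ->] := KM_repr x; rewrite !KM_pairing_piE.
apply: (freeg_ext (h := freeg_pairing (g + h))
  (h' := GRing.add_fun (freeg_pairing g) (freeg_pairing h))) => f /=.
by rewrite /freeg_pairing /= !freeg_liftU; exact: pairingDl.
Qed.

Lemma dlog_one_form (u : units (iterL A n)) :
  dlog u = one_form (fun j : 'I_n => uinv u * pderiv A n j (uval u)).
Proof.
apply/ffunP => I; rewrite !ffunE !sum_ffunE mulr_sumr; apply: eq_bigr => j _.
by rewrite !ffunE mulrA.
Qed.

(** With [P] the matrix of ordinary partial derivatives, the wedge has coefficient [\det P] divided
    by the product of the [f k], and the logarithmic Jacobian is [\det P] times the product of the
    [t_j], a factor that turns the constant coefficient into the residue. *)
Lemma wghost_KM_pairing f g i : S i ->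
  wghost (KM_pairing (symb f) g) i =
  residue (fscale (wghost g i) (\big[@wedge _ n/fone _ n]_(k < n) dlog (f k))).
Proof.
move=> Si; have i0 := tset_gt0 Si.
rewrite KM_pairing_piE /freeg_pairing freeg_liftU wghost_pairing// pairing_ghostE//.
rewrite /residue ffunE [\big[@wedge _ n/_]_(k < n) _](eq_bigr _ (fun k _ => dlog_one_form (f k))).
have -> : [set: 'I_n]%SET = [set (id : 'I_n -> 'I_n) i | i in 'I_n]%SET.
  by apply/setP => j; rewrite inE imset_f.
rewrite wedge_one_forms// -const_coef_tvar; congr const_coef.
pose P : 'M[iterL A n]_n := \matrix_(k, j) pderiv A n j (uval (f k)).
have -> : \matrix_(k, j) (uinv (f k) * pderiv A n j (uval (f k))) =
    diag_mx (\row_k uinv (f k)) *m P.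
  by apply/matrixP => k j; rewrite mul_diag_mx !mxE.
have -> : jacobian (fun j : 'I_n => theta A n j) (fun k => uval (f k)) =
    P *m diag_mx (\row_j tvar A n j).
  by apply/matrixP => k j; rewrite mul_mx_diag !mxE theta_pderiv mulrC.
rewrite !det_mulmx !det_diag.
have -> : \prod_l (\row_k uinv (f k)) 0 l = \prod_k uinv (f k).
  by apply: eq_bigr => k _; rewrite mxE.
under [\prod_(j < n) _ 0 j]eq_bigr => j _ do rewrite mxE.
set V := \prod_k uinv (f k); have VU : V * \prod_k uval (f k) = 1.
  by rewrite -big_split big1// => k _; rewrite /= mulrC uvalV.
(* The [i]-th powers of the inverses against the powers [i - 1] of the units leave one inverse of
   each unit. *)
have {VU} VU : V ^+ i * \prod_k uval (f k) ^+ i.-1 = V.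
  by rewrite prodrXl -{1}(prednK i0) exprS -mulrA -exprMn VU expr1n mulr1.
rewrite -[_ * _ * \prod_k uval (f k) ^+ _]mulrA VU; ring.
Qed.

End KMPairing.

Lemma KM_pairing_map (n : nat) (S : truncset) (A B : comPzRingType)
    (phi : {rmorphism A -> B}) (x : KM n (iterL A n)) (g : witt S (iterL A n)) :
  KM_pairing (KM_map (iterL_map phi n) x) (witt_map (iterL_map phi n) g) =
  witt_map phi (KM_pairing x g).
Proof.
have [z ->] := KM_repr x; rewrite KM_map_pi tpow_map_pi KM_pairing_pi !KM_pairing_piE.
pose h : {additive {freeg {ffun 'I_n -> units (iterL A n)}} -> witt S B} :=
  tpow_pairing (witt_map (iterL_map phi n) g) \o freeg_map (iterL_map phi n).
pose h' : {additive {freeg {ffun 'I_n -> units (iterL A n)}} -> witt S B} :=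
  @witt_map S _ _ phi \o freeg_pairing g.
apply: (freeg_ext (h := h) (h' := h')) => f; rewrite /h /h' /=.
rewrite freeg_mapU tpow_pairing_pi /freeg_pairing !freeg_liftU /symbol_pairing.
rewrite -pairing_map rmorph_prod; congr pairing.
  by apply: eq_bigr => k _; rewrite ffunE.
by apply: funext => k; rewrite ffunE.
Qed.

Theorem proposition9p3 (n : nat) (n_ge1 : (1 <= n)%N) (S : truncset) :
  exists P : forall A : comPzRingType,
      KM n (iterL A n) -> witt S (iterL A n) -> witt S A,
  [/\ forall (A : comPzRingType) (x y : KM n (iterL A n)) (g : witt S (iterL A n)),
        P A (x + y) g = P A x g + P A y g,
      forall (A : comPzRingType) (x : KM n (iterL A n)) (g h : witt S (iterL A n)),
        P A x (g + h) = P A x g + P A x h,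
      forall (A B : comPzRingType) (phi : {rmorphism A -> B})
          (x : KM n (iterL A n)) (g : witt S (iterL A n)),
        P B (KM_map (iterL_map phi n) x) (witt_map (iterL_map phi n) g) =
        witt_map phi (P A x g)
    & forall (A : comPzRingType) (f : {ffun 'I_n -> units (iterL A n)})
          (g : witt S (iterL A n)) (i : nat), S i ->
        wghost (P A (symb f) g) i =
        residue (fscale (wghost g i) (\big[@wedge _ n/fone _ n]_(k < n) dlog (f k)))].
Proof.
exists (fun A => @KM_pairing n S A); split.
- by move=> A; exact: KM_pairingDl.
- by move=> A; exact: KM_pairingDr.
- by move=> A B; exact: KM_pairing_map.
- by move=> A; exact: wghost_KM_pairing.
Qed.
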